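(* Let $-3\le\gamma\le 1$, $\Lambda_0\in[0,\infty)$, and let $(B_\varepsilon)_{\varepsilon>0}$, $B_\varepsilon(q,\theta)=|q|^\gamma b_\varepsilon(\cos\theta)$, be a family of collision kernels concentrating on grazing collisions with limit cross-section $\Lambda_0$, i.e. such that $$\text{a)}\quad \Lambda_\varepsilon:=2\pi\int_0^{\pi/2} b_\varepsilon(\cos\theta)(1-\cos\theta)\sin\theta\,d\theta\longrightarrow\Lambda_0<\infty\quad(\varepsilon\to0),$$ $$\text{b)}\quad \text{for all }\theta_1>0,\quad b_\varepsilon(\cos\theta)\longrightarrow 0\ \text{ uniformly on }\{\theta\ge\theta_1\}\quad(\varepsilon\to0).$$ Let $\hat\beta_\varepsilon(l,m)$ be the Boltzmann kernel modes associated with $B_\varepsilon$, and let $\hat\beta_L(l,m)$ be the Fokker-Planck-Landau kernel modes associated with $$\Psi(|q|)=\frac{\Lambda_0}{8}|q|^{\gamma+2}.$$ Then for all $l,m\in\mathbb{Z}^3$, $$\lim_{\varepsilon\to0}\hat\beta_\varepsilon(l,m)=\hat\beta_L(l,m).$$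
   Context: Fix $\lambda=2/(3+\sqrt2)$ and let $\mathcal{B}(0,2\lambda\pi)\subset\mathbb{R}^3$ be the ball of radius $2\lambda\pi$ centered at the origin. The angular functions $b_\varepsilon$ are nonnegative, supported in deflection angles $\theta\in[0,\pi/2]$ (that is, $b_\varepsilon(\cos\theta)=0$ for $\theta>\pi/2$), and may have a nonintegrable singularity at $\theta=0$. Boltzmann kernel modes: for $l,m\in\mathbb{Z}^3$, $$\hat\beta_\varepsilon(l,m)=\int_{\mathcal{B}(0,2\lambda\pi)}dq\,e^{iq\cdot m}\int_{S^2}d\sigma\,B_\varepsilon(q,\theta)\left[e^{i\frac{l-m}{2}\cdot(q-|q|\sigma)}-1\right],\qquad \cos\theta=\frac{q\cdot\sigma}{|q|}.$$ The integral over $\sigma$ is taken in spherical coordinates around $q$: with $(q/|q|,j,h)$ an orthonormal basis, $|q|\sigma=q\cos\theta+j|q|\sin\theta\sin\phi+h|q|\sin\theta\cos\phi$, $d\sigma=\sin\theta\,d\theta\,d\phi$, the integration in $\phi\in[0,2\pi]$ being performed first and then the integration in $\theta$. Fokker-Planck-Landau kernel modes associated with a function $\Psi$: for $l,m\in\mathbb{Z}^3$, with $k=l+m$, $$\hat\beta_L(l,m)=-4\int_{\mathcal{B}(0,2\lambda\pi)}dq\,e^{iq\cdot m}\,\frac{\Psi(|q|)}{|q|^2}\left\{i\,q\cdot k+\frac14|q|^2\,|k^\perp|^2\right\},\qquad k^\perp=k-\left(k\cdot\frac{q}{|q|}\right)\frac{q}{|q|}.$$ These are the modes obtained by applying the Fourier-Galerkin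 spectral method on $[-\pi,\pi]^3$ to the spatially homogeneous Fokker-Planck-Landau operator $Q_L(f,f)=\nabla_v\cdot\int a(v-v_* )[f_*\nabla_v f-f(\nabla_v f)_*]\,dv_*$, $a_{ij}(z)=\Psi(|z|)(\delta_{ij}-z_iz_j/|z|^2)$, with relative velocity truncated to $|q|\le 2\lambda\pi$. *)

(* Defs.v *)
From HB Require Import structures.
From mathcomp Require Import all_boot all_order all_algebra.
From mathcomp Require Import complex.
From mathcomp Require Import all_classical all_reals all_analysis.

Set Implicit Arguments.
Unset Strict Implicit.
Unset Printing Implicit Defensive.

Import Order.TTheory GRing.Theory Num.Theory.
Import numFieldNormedType.Exports.

Local Open Scope classical_set_scope.
Local Open Scope ring_scope.

Section complex_valued.
Context {R : realType}.

Definition expi (x : R) : R[i] := Complex (cos x) (sin x).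

Definition Cintegral d (T : measurableType d) (mu : {measure set T -> \bar R})
    (D : set T) (f : T -> R[i]) : R[i] :=
  Complex (\int[mu]_(x in D) complex.Re (f x)) (\int[mu]_(x in D) complex.Im (f x)).

End complex_valued.

Section space.
Context {R : realType}.

Definition dotv (u v : 'rV[R]_3) : R := \sum_(i < 3) u 0 i * v 0 i.

(* The norm that the library puts on row vectors is the sup norm. *)
Definition normv (u : 'rV[R]_3) : R := Num.sqrt (dotv u u).

Definition unitv (u : 'rV[R]_3) : 'rV[R]_3 := (normv u)^-1 *: u.

Definition perpv (k q : 'rV[R]_3) : 'rV[R]_3 := k - dotv k (unitv q) *: unitv q.

Definition orthonormal3 (u v w : 'rV[R]_3) : Prop :=
  [/\ normv u = 1, normv v = 1 & normv w = 1] /\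
  [/\ dotv u v = 0, dotv u w = 0 & dotv v w = 0].

Definition freq (l : 'rV[int]_3) : 'rV[R]_3 := map_mx intr l.

(* Three-dimensional Lebesgue measure is carried by R * R * R (row vectors have
   no measurable structure in the library); integration variables are turned
   into row vectors by [vec]. *)
Definition vec (p : R * R * R) : 'rV[R]_3 :=
  \row_(i < 3) [:: p.1.1; p.1.2; p.2]`_i.

Definition Cint3 (D : set 'rV[R]_3) (f : 'rV[R]_3 -> R[i]) : R[i] :=
  Cintegral (lebesgue_measure \x lebesgue_measure \x lebesgue_measure)%E
    (vec @^-1` D) (f \o vec).

Definition euclidean_ball (r : R) : set 'rV[R]_3 := [set q | normv q <= r].

End space.

Section kernel_modes.
Context {R : realType}.

Definition lambda : R := 2 / (3 + Num.sqrt 2).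

(* The vector |q| sigma, where sigma has spherical coordinates (theta, phi) in
   the frame (q / |q|, j, h). *)
Definition post_relative_velocity (q j h : 'rV[R]_3) (theta phi : R) :
    'rV[R]_3 :=
  cos theta *: q + (normv q * sin theta * sin phi) *: j
    + (normv q * sin theta * cos phi) *: h.

(* For q != 0, (q / |q|, j q, h q) is meant to be an orthonormal basis. *)
Definition boltzmann_mode (j h : 'rV[R]_3 -> 'rV[R]_3)
    (B : 'rV[R]_3 -> R -> R) (l m : 'rV[int]_3) : R[i] :=
  Cint3 (euclidean_ball (2 * lambda * pi)) (fun q =>
    expi (dotv q (freq m)) *
    Cintegral lebesgue_measure `[0, pi] (fun theta =>
      Cintegral lebesgue_measure `[0, 2 * pi] (fun phi =>
        (B q theta * sin theta)%:C%C *
        (expi (dotv (2^-1 *: freq (l - m))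
                 (q - post_relative_velocity q (j q) (h q) theta phi)) - 1)))).

Definition landau_mode (Psi : R -> R) (l m : 'rV[int]_3) : R[i] :=
  let k := freq (l + m) in
  - 4 * Cint3 (euclidean_ball (2 * lambda * pi)) (fun q =>
    expi (dotv q (freq m)) * (Psi (normv q) / normv q ^+ 2)%:C%C *
    ('i * (dotv q k)%:C%C
     + (4^-1 * normv q ^+ 2 * normv (perpv k q) ^+ 2)%:C%C)).

End kernel_modes.

Section grazing_collisions.
Context {R : realType}.

(* The deflection angle 0 is excluded: [b] may be singular at [cos 0 = 1]. *)
Definition angular_function (b : R -> R) : Prop :=
  [/\ measurable_fun (`[-1, 1[ : set R) b,
      forall theta, theta \in `]0, pi] -> 0 <= b (cos theta)
    & forall theta, theta \in `]pi / 2, pi] -> b (cos theta) = 0].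

Definition variable_collision_kernel (gamma : R) (b : R -> R)
    (q : 'rV[R]_3) (theta : R) : R :=
  normv q `^ gamma * b (cos theta).

(* Extended-real valued, so that a divergent integral is [+oo]. *)
Definition cross_section (b : R -> R) : \bar R :=
  ((2 * pi)%:E * \int[lebesgue_measure]_(theta in `[0%R, (pi / 2)%R])
     (b (cos theta) * (1 - cos theta) * sin theta)%:E)%E.

Definition concentrates_on_grazing (b : R -> R -> R) (Lambda0 : R) : Prop :=
  cross_section (b eps) @[eps --> 0^'+] --> Lambda0%:E /\
  forall theta1, 0 < theta1 ->
    {uniform `[theta1, pi], (fun eps theta => b eps (cos theta)) @ 0^'+
       --> (fun=> 0 : R)}.

End grazing_collisions.

(* Main.v *)
Require Import Defs.
From HB Require Import structures.
From mathcomp Require Import all_boot all_order all_algebra.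
From mathcomp Require Import complex ring lra.
From mathcomp Require Import all_classical all_reals all_analysis.
From mathcomp Require Import measurable_realfun.
Import Order.TTheory GRing.Theory Num.Theory.
Import numFieldNormedType.Exports.
Local Open Scope classical_set_scope.
Local Open Scope ring_scope.

Set Implicit Arguments.
Unset Strict Implicit.
Unset Printing Implicit Defensive.

(** Expand the phase [exp (i v . (q - |q| sigma)) - 1], [v = (l - m) / 2], in the
    deflection angle [theta]. The first-order term is a harmonic of the azimuth
    and integrates to zero; the next order gives, with [w = 1 - cos theta],
    [2 pi w (i v . q - |q|^2 |v_perp|^2 / 2)] up to [O(|q| w^2)]
    ([scattered_wave_taylor]). When the kernels concentrate on grazing
    collisions, the moments of [w] tend to [Lambda0] while those of [w^2] tend to
    [0] ([second_moment_cvg0]), so the Boltzmann modes tend to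
    [Lambda0] times the integral over the ball of
    [exp (i q . m) |q|^gamma (i v . q - |q|^2 |v_perp|^2 / 2)]
    ([mean_scattered_cvg]). The error is uniform in [q] relatively to
    [|q|^(gamma + 1)], which is integrable for [gamma >= -3]
    ([admissible_radial_power]).

    The Landau modes involve [k = l + m] instead of [l - m], and the two
    integrands differ. Their difference is a multiple of the divergence of the
    vector field [|q|^gamma exp (i q . m) (|q|^2 l - (l . q) q)], tangent to the
    spheres centered at the origin, so its integral over the ball vanishes
    ([null_integral_tangential_divergence], [landau_modeE]). This divergence is a
    combination of derivatives along rotations, and the integral of such a
    derivative against a radial weight vanishes because Lebesgue measure is
    invariant under rotations ([Rintegral_angular_derivative]), which are
    products of shears ([rot_shears]).

    Real and imaginary parts are treated together: both are given by the real
    part of a wave, with an additional phase [k] equal to [0] or to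
    [- (pi / 2)]. *)

(** * Elementary bounds for sine and cosine *)

Section trigonometric_bounds.
Context {R : realType}.
Implicit Types x y z u d : R.

(** One formulation for both signs of [x]; every bound below follows from it
    and the double-angle formula. *)
Lemma MVT_from0 (f df : R -> R) x : (forall y, is_derive y 1 f (df y)) ->
  exists2 c, `|c| <= `|x| & f x - f 0 = df c * x.
Proof.
move=> fdf.
have cf : continuous f.
  by move=> y; apply: differentiable_continuous; apply/derivable1_diffP;
     have [] := fdf y.
case: (ltgtP x 0) => x0.
- have [c /[!in_itv]/= /andP[xc c0]] :=
    MVT x0 (fun y _ => fdf y) (continuous_subspaceT cf).
  rewrite sub0r mulrN => e; exists c.
    by rewrite !ltr0_norm// lerN2 ltW.
  by rewrite -[RHS]opprK -e opprB.
- have [c /[!in_itv]/= /andP[c0 cx]] :=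
    MVT x0 (fun y _ => fdf y) (continuous_subspaceT cf).
  by rewrite subr0 => e; exists c => //; rewrite !gtr0_norm// ltW.
- by exists 0; rewrite ?x0 ?normr0// subrr mulr0.
Qed.

Lemma norm_sin_le x : `|sin x| <= `|x|.
Proof.
have [c _] := MVT_from0 x (@is_derive_sin R).
rewrite sin0 subr0 => ->; rewrite normrM -[leRHS]mul1r.
by apply: ler_wpM2r => //; exact: cos_max.
Qed.

Lemma cos_half x : 1 - cos x = 2 * sin (x / 2) ^+ 2.
Proof.
have {1}-> : x = (x / 2) *+ 2 by rewrite -mulr_natr -mulrA mulVf ?mulr1.
by rewrite cos_mulr2n cos2sin2; ring.
Qed.

Lemma norm_sqr x : `|x| ^+ 2 = x ^+ 2.
Proof. by rewrite -normrX ger0_norm ?sqr_ge0. Qed.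

Lemma one_sub_cos_ge0 x : 0 <= 1 - cos x.
Proof. by rewrite subr_ge0 cos_le1. Qed.

Lemma one_sub_cos_le x : 1 - cos x <= x ^+ 2 / 2.
Proof.
rewrite cos_half.
have : sin (x / 2) ^+ 2 <= (x / 2) ^+ 2.
  by rewrite -norm_sqr -(norm_sqr (x / 2)) lerXn2r ?nnegrE// norm_sin_le.
lra.
Qed.

Lemma norm_sin_sub_le x : `|sin x - x| <= `|x| ^+ 3 / 2.
Proof.
have D y : is_derive y 1 (fun t => sin t - t) (cos y - 1).
  exact: is_deriveB.
have [c cx] := MVT_from0 x D; rewrite sin0 !subr0 => ->.
rewrite normrM exprSr mulrAC ler_wpM2r// distrC ger0_norm ?one_sub_cos_ge0//.
apply: (le_trans (one_sub_cos_le _)).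
by rewrite ler_wpM2r// -norm_sqr lerXn2r ?nnegrE.
Qed.

Lemma norm_sin_sub_le2 x : `|sin x - x| <= x ^+ 2.
Proof.
have D y : is_derive y 1 (fun t => sin t - t) (cos y - 1).
  exact: is_deriveB.
have [c cx] := MVT_from0 x D; rewrite sin0 !subr0 => ->.
rewrite normrM -norm_sqr expr2 ler_wpM2r// (le_trans _ cx)//.
have [e ec] := MVT_from0 c (@is_derive_cos R).
rewrite cos0 => ->; rewrite normrM normrN -[leRHS]mul1r.
by rewrite ler_wpM2r// sin_max.
Qed.

Lemma norm_cosD_sub_le u d : `|cos (u + d) - cos u| <= `|d|.
Proof.
have D y : is_derive y 1 (fun t => cos (u + t)) (- sin (u + y)).
  have /(is_derive1_comp (f := cos)) : is_derive y 1 (fun t => u + t) 1.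
    by rewrite -[X in is_derive _ _ _ X](add0r 1); apply: is_deriveD.
  by rewrite mulr1.
have [c _] := MVT_from0 d D; rewrite addr0 => ->.
by rewrite normrM normrN -[leRHS]mul1r ler_wpM2r// sin_max.
Qed.

Lemma norm_cosD_taylor u d : `|cos (u + d) - cos u + d * sin u| <= 2 * d ^+ 2.
Proof.
rewrite cosD.
have -> : cos u * cos d - sin u * sin d - cos u + d * sin u =
  - (cos u * (1 - cos d)) - sin u * (sin d - d) by ring.
rewrite (le_trans (ler_normB _ _))// normrN !normrM.
have h1 : `|cos u| * `|1 - cos d| <= d ^+ 2.
  rewrite (ger0_norm (one_sub_cos_ge0 d)).
  have : `|cos u| * (1 - cos d) <= 1 * (d ^+ 2 / 2).
    by rewrite ler_pM ?one_sub_cos_ge0 ?cos_max ?one_sub_cos_le.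
  have := sqr_ge0 d; lra.
have h2 : `|sin u| * `|sin d - d| <= d ^+ 2.
  rewrite -[leRHS]mul1r.
  by apply: ler_pM => //; [exact: sin_max|exact: norm_sin_sub_le2].
lra.
Qed.

(** Writing [1 - cos z] as [2 sin^2 (z / 2)] turns a fourth-order estimate of
    the cosine into the third-order estimate of the sine. *)
Lemma norm_cos_taylor4 z : `|cos z - 1 + z ^+ 2 / 2| <= z ^+ 4.
Proof.
have -> : cos z - 1 + z ^+ 2 / 2 =
    - (2 * ((sin (z / 2) - z / 2) * (sin (z / 2) + z / 2))).
  by rewrite -[cos z - 1]opprB cos_half; field.
set y := z / 2.
rewrite normrN !normrM (ger0_norm (ler0n _ 2)).
have h1 := norm_sin_sub_le y.
have h2 : `|sin y + y| <= 2 * `|y|.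
  by rewrite (le_trans (ler_normD _ _))//; have := norm_sin_le y; lra.
have -> : z ^+ 4 = 16 * `|y| ^+ 4.
  by rewrite -normrX ger0_norm /y; [field|rewrite exprn_even_ge0].
have : `|sin y - y| * `|sin y + y| <= `|y| ^+ 3 / 2 * (2 * `|y|).
  by rewrite ler_pM.
have -> : `|y| ^+ 3 / 2 * (2 * `|y|) = `|y| ^+ 4 by field.
have := exprn_ge0 4 (normr_ge0 y); lra.
Qed.

End trigonometric_bounds.

(** * Measure-preserving maps of a product space *)

Section sigma_finite_product.
Context d1 d2 (T1 : measurableType d1) (T2 : measurableType d2) (R : realType).
Variable m1 : {sigma_finite_measure set T1 -> \bar R}.
Variable m2 : {sigma_finite_measure set T2 -> \bar R}.

(** A name for the product measure that carries its sigma-finiteness, so that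
    products can be iterated. *)
Definition sf_product : set (T1 * T2) -> \bar R := (m1 \x m2)%E.

HB.instance Definition _ := Measure.copy sf_product (m1 \x m2)%E.

Let sigma_finite_sf_product : sigma_finite setT sf_product.
Proof.
have /sigma_finiteP[F [TF ndF Foo]] := sigma_finiteT m1.
have /sigma_finiteP[G [TG ndG Goo]] := sigma_finiteT m2.
exists (fun n => F n `*` G n).
  rewrite -setXTT TF TG; apply/seteqP; split => -[x y]/=.
    move=> [[n _ Fnx] [k _ Gky]]; exists (maxn n k) => //; split.
    - by move: x Fnx; exact/subsetPset/ndF/leq_maxl.
    - by move: y Gky; exact/subsetPset/ndG/leq_maxr.
  by move=> [n _ []/= ? ?]; split; exists n.
move=> k; have [? ?] := Foo k; have [? ?] := Goo k.
split; first exact: measurableX.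
by rewrite /sf_product product_measure1E// lte_mul_pinfty// ge0_fin_numE.
Qed.

HB.instance Definition _ :=
  Measure_isSigmaFinite.Build _ _ _ sf_product sigma_finite_sf_product.

End sigma_finite_product.

Section measure_preserving_maps.
Context {R : realType}.

Definition preserves d (T : measurableType d) (mu : set T -> \bar R)
    (phi : T -> T) : Prop :=
  measurable_fun setT phi /\
  forall A, measurable A -> mu (phi @^-1` A) = mu A.

Lemma preserves_comp d (T : measurableType d) (mu : set T -> \bar R)
    (phi psi : T -> T) :
  preserves mu phi -> preserves mu psi -> preserves mu (phi \o psi).
Proof.
move=> [mphi phiE] [mpsi psiE]; split; first exact: measurableT_comp.
move=> A mA; rewrite comp_preimage psiE ?phiE//.
by rewrite -[X in measurable X]setTI; exact: mphi.
Qed.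

Lemma ge0_integral_preserves d (T : measurableType d)
    (mu : {measure set T -> \bar R}) (phi : T -> T) (f : T -> \bar R) :
  preserves mu phi -> measurable_fun setT f -> (forall x, (0 <= f x)%E) ->
  (\int[mu]_x f (phi x) = \int[mu]_x f x)%E.
Proof.
move=> [mphi phiE] mf f0.
rewrite -[LHS](@ge0_integral_pushforward _ _ T T R phi mphi mu setT f
  measurableT mf (fun x _ => f0 x)).
by apply: eq_measure_integral => A mA _; exact: phiE.
Qed.

Lemma Rintegral_preserves d (T : measurableType d)
    (mu : {measure set T -> \bar R}) (phi : T -> T) (f : T -> R) :
  preserves mu phi -> measurable_fun setT f ->
  \int[mu]_x f (phi x) = \int[mu]_x f x.
Proof.
move=> phimu mf.
have mEf : measurable_fun setT (EFin \o f) by exact/measurable_EFinP.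
congr fine; rewrite integralE [RHS]integralE.
congr (_ - _)%E.
- apply: etrans (ge0_integral_preserves phimu (measurable_funepos mEf) _).
  + by apply: eq_integral => x _; rewrite !unlock.
  + by [].
- apply: etrans (ge0_integral_preserves phimu (measurable_funeneg mEf) _).
  + by apply: eq_integral => x _; rewrite !unlock.
  + by [].
Qed.

(** By Fubini, it suffices that each section be preserved. *)
Lemma preserves_fiber_snd d1 d2 (T1 : measurableType d1)
    (T2 : measurableType d2) (m1 : {sigma_finite_measure set T1 -> \bar R})
    (m2 : {sigma_finite_measure set T2 -> \bar R}) (phi : T1 -> T2 -> T2) :
  measurable_fun setT (fun p : T1 * T2 => phi p.1 p.2) ->
  (forall x, preserves m2 (phi x)) ->
  preserves (sf_product m1 m2) (fun p => (p.1, phi p.1 p.2)).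
Proof.
move=> mphi phiE.
have mT : measurable_fun setT (fun p : T1 * T2 => (p.1, phi p.1 p.2)).
  exact: measurable_fun_pair.
split => // A mA; rewrite /product_measure1/=; apply: eq_integral => x _ /=.
rewrite -[RHS]((phiE x).2 _ (measurable_xsection x mA)).
by congr (m2 _); apply/seteqP; split => y; rewrite /xsection/= !inE.
Qed.

Lemma sf_product_ysection d1 d2 (T1 : measurableType d1)
    (T2 : measurableType d2) (m1 : {sigma_finite_measure set T1 -> \bar R})
    (m2 : {sigma_finite_measure set T2 -> \bar R}) (A : set (T1 * T2)) :
  measurable A ->
  sf_product m1 m2 A = (\int[m2]_y (m1 (ysection A y)))%E.
Proof.
move=> mA.
have := indic_fubini_tonelli m1 m2 mA.
by rewrite indic_fubini_tonelli_FE// indic_fubini_tonelli_GE.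
Qed.

Lemma preserves_fiber_fst d1 d2 (T1 : measurableType d1)
    (T2 : measurableType d2) (m1 : {sigma_finite_measure set T1 -> \bar R})
    (m2 : {sigma_finite_measure set T2 -> \bar R}) (phi : T2 -> T1 -> T1) :
  measurable_fun setT (fun p : T1 * T2 => phi p.2 p.1) ->
  (forall y, preserves m1 (phi y)) ->
  preserves (sf_product m1 m2) (fun p => (phi p.2 p.1, p.2)).
Proof.
move=> mphi phiE.
have mT : measurable_fun setT (fun p : T1 * T2 => (phi p.2 p.1, p.2)).
  exact: measurable_fun_pair.
split => // A mA.
rewrite !sf_product_ysection//; last first.
  by rewrite -[X in measurable X]setTI; exact: mT.
apply: eq_integral => y _ /=.
rewrite -[RHS]((phiE y).2 _ (measurable_ysection y mA)).
by congr (m1 _); apply/seteqP; split => x; rewrite /ysection/= !inE.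
Qed.

Lemma preserves_translation (c : R) :
  preserves (@lebesgue_measure R) (fun x => x + c).
Proof.
have mc : measurable_fun setT (fun x : R => x + c) by exact: measurable_funD.
split=> // A mA.
pose T : R -> measurableTypeR R := fun x => x + c.
have mT : measurable_fun setT T by [].
apply/esym/(@lebesgue_measure_unique R (pushforward lebesgue_measure T)) => //=
  _ [[a b]] _ <-.
rewrite /pushforward.
have -> : T @^-1` `]a, b]%classic = `](a - c), (b - c)]%classic.
  apply/seteqP; split => x; rewrite /T /= !in_itv/=; lra.
rewrite !lebesgue_measure_itv/= !lte_fin ltrD2r -!EFinB.
by congr (if _ then _ else _); congr EFin; ring.
Qed.

End measure_preserving_maps.

(** * Shears and rotations of space *)

Section rotations.
Context {R : realType}.
Implicit Types (p : R * R * R) (q u : 'rV[R]_3) (a b : 'I_3) (t s c : R).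

Local Notation mu1 := (@lebesgue_measure R).
Local Notation mu2 := (sf_product mu1 mu1).
Local Notation mu3 := (sf_product mu2 mu1).

Definition unvec q : R * R * R :=
  (q 0 (inord 0), q 0 (inord 1), q 0 (inord 2)).

Lemma ord3P (P : 'I_3 -> Prop) :
  P (inord 0) -> P (inord 1) -> P (inord 2) -> forall i, P i.
Proof.
move=> P0 P1 P2 [[|[|[|//]]] i3].
- by rewrite (_ : Ordinal _ = inord 0)//; apply/val_inj; rewrite /= inordK.
- by rewrite (_ : Ordinal _ = inord 1)//; apply/val_inj; rewrite /= inordK.
- by rewrite (_ : Ordinal _ = inord 2)//; apply/val_inj; rewrite /= inordK.
Qed.

Lemma vec0 p : vec p 0 (inord 0) = p.1.1. Proof. by rewrite mxE inordK. Qed.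
Lemma vec1 p : vec p 0 (inord 1) = p.1.2. Proof. by rewrite mxE inordK. Qed.
Lemma vec2 p : vec p 0 (inord 2) = p.2. Proof. by rewrite mxE inordK. Qed.
Definition vecE := (vec0, vec1, vec2).

Lemma unvecK : cancel unvec vec.
Proof. by move=> q; apply/rowP; elim/ord3P; rewrite vecE. Qed.

Lemma measurable_coord i : measurable_fun setT (fun p => vec p 0 i).
Proof.
elim/ord3P: i.
- under eq_fun do rewrite vecE.
  by apply: measurableT_comp => //; exact: measurable_fst.
- under eq_fun do rewrite vecE.
  by apply: measurableT_comp => //; exact: measurable_fst.
- by under eq_fun do rewrite vecE; exact: measurable_snd.
Qed.

Definition shear a b t q : 'rV[R]_3 := q + (t * q 0 b) *: delta_mx 0 a.

Lemma shearE a b t p :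
  (unvec \o shear a b t \o vec) p =
  let d i := t * vec p 0 b * (i == a)%:R in
  (p.1.1 + d (inord 0), p.1.2 + d (inord 1), p.2 + d (inord 2)).
Proof. by rewrite /unvec /shear/= !mxE !inordK. Qed.

(** A shear translates one coordinate by an amount that depends on the others
    only, so it acts on the lines parallel to an axis by translations. *)
Lemma preserves_shear a b t : a != b ->
  preserves mu3 (unvec \o shear a b t \o vec).
Proof.
have E (i j : nat) : (i < 3)%N -> (j < 3)%N ->
    ((inord i : 'I_3) == inord j) = (i == j).
  by move=> i3 j3; rewrite -val_eqE/= !inordK.
have mT (X : R * R * R -> R) (Y : R * R * R -> R) : measurable_fun setT X ->
    measurable_fun setT Y -> measurable_fun setT (fun p => X p + t * Y p).
  by move=> mX mY; apply: measurable_funD => //; exact: measurable_funM.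
have mS (X : R * R -> R) (Y : R * R -> R) : measurable_fun setT X ->
    measurable_fun setT Y ->
    measurable_fun setT (fun p : R * R => X p + t * Y p).
  by move=> mX mY; apply: measurable_funD => //; exact: measurable_funM.
have m11 : measurable_fun setT (fun p : R * R * R => p.1.1).
  by apply: measurableT_comp => //; exact: measurable_fst.
have m12 : measurable_fun setT (fun p : R * R * R => p.1.2).
  by apply: measurableT_comp => //; exact: measurable_fst.
have m2 : measurable_fun setT (fun p : R * R * R => p.2).
  exact: measurable_snd.
rewrite (funext (shearE a b t)).
elim/ord3P: a; elim/ord3P: b; rewrite !E// ?eqxx//= => _;
  under eq_fun do rewrite !vecE !E//= ?mulr1 ?mulr0 ?addr0.
- apply: (@preserves_fiber_fst _ _ _ _ _ mu2 mu1
    (fun _ x => (x.1 + t * x.2, x.2))).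
    by apply: measurable_fun_pair => //; exact: mT.
  move=> _; apply: (@preserves_fiber_fst _ _ _ _ _ mu1 mu1
    (fun y x => x + t * y)); first exact: mS.
  move=> y; exact: preserves_translation.
- apply: (@preserves_fiber_fst _ _ _ _ _ mu2 mu1
    (fun z x => (x.1 + t * z, x.2))).
    by apply: measurable_fun_pair => //; exact: mT.
  move=> z; apply: (@preserves_fiber_fst _ _ _ _ _ mu1 mu1
    (fun _ x => x + t * z)); first exact: measurable_funD.
  move=> _; exact: preserves_translation.
- apply: (@preserves_fiber_fst _ _ _ _ _ mu2 mu1
    (fun _ x => (x.1, x.2 + t * x.1))).
    by apply: measurable_fun_pair => //; exact: mT.
  move=> _; apply: (@preserves_fiber_snd _ _ _ _ _ mu1 mu1
    (fun x y => y + t * x)); first exact: mS.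
  move=> y; exact: preserves_translation.
- apply: (@preserves_fiber_fst _ _ _ _ _ mu2 mu1
    (fun z x => (x.1, x.2 + t * z))).
    by apply: measurable_fun_pair => //; exact: mT.
  move=> z; apply: (@preserves_fiber_snd _ _ _ _ _ mu1 mu1
    (fun _ y => y + t * z)); first exact: measurable_funD.
  move=> _; exact: preserves_translation.
- have -> : (fun x : R * R * R => (x.1.1, x.1.2, x.2 + t * x.1.1)) =
    (fun x => (x.1, x.2 + t * x.1.1)) by apply/funext => -[[]].
  apply: (@preserves_fiber_snd _ _ _ _ _ mu2 mu1
    (fun x z => z + t * x.1)); first exact: mT.
  move=> x; exact: preserves_translation.
- have -> : (fun x : R * R * R => (x.1.1, x.1.2, x.2 + t * x.1.2)) =
    (fun x => (x.1, x.2 + t * x.1.2)) by apply/funext => -[[]].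
  apply: (@preserves_fiber_snd _ _ _ _ _ mu2 mu1
    (fun x z => z + t * x.2)); first exact: mT.
  move=> x; exact: preserves_translation.
Qed.

Lemma dotvE (u v : 'rV[R]_3) : dotv u v =
  u 0 (inord 0) * v 0 (inord 0) + u 0 (inord 1) * v 0 (inord 1)
  + u 0 (inord 2) * v 0 (inord 2).
Proof.
have o (k : nat) (k3 : (k < 3)%N) (i : 'I_3) : val i = k -> i = inord k.
  by move=> ik; apply/val_inj; rewrite /= inordK.
rewrite /dotv !big_ord_recl big_ord0 addr0 addrA.
by rewrite (o 2%N _ (lift ord0 (lift ord0 ord0)))//
  (o 1%N _ (lift ord0 ord0))// (o 0%N _ ord0).
Qed.

Lemma dotvC (u v : 'rV[R]_3) : dotv u v = dotv v u.
Proof. by rewrite !dotvE; ring. Qed.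

Lemma dotvDl (u v w : 'rV[R]_3) : dotv (u + v) w = dotv u w + dotv v w.
Proof. by rewrite !dotvE !mxE; ring. Qed.

Lemma dotvZl (k : R) (u v : 'rV[R]_3) : dotv (k *: u) v = k * dotv u v.
Proof. by rewrite !dotvE !mxE; ring. Qed.

Lemma dotv_delta a (u : 'rV[R]_3) : dotv (delta_mx 0 a) u = u 0 a.
Proof.
rewrite /dotv (bigD1 a)//= big1 ?addr0 ?mxE ?eqxx ?mul1r//.
by move=> i ia; rewrite mxE (negbTE ia) andbF mul0r.
Qed.

Lemma dotvDr (u v w : 'rV[R]_3) : dotv u (v + w) = dotv u v + dotv u w.
Proof. by rewrite dotvC dotvDl !(dotvC u). Qed.

Lemma dotvZr (k : R) (u v : 'rV[R]_3) : dotv u (k *: v) = k * dotv u v.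
Proof. by rewrite dotvC dotvZl dotvC. Qed.

Lemma dotvv_ge0 (u : 'rV[R]_3) : 0 <= dotv u u.
Proof. by apply: sumr_ge0 => i _; rewrite -expr2 sqr_ge0. Qed.

Lemma normv_ge0 (u : 'rV[R]_3) : 0 <= normv u.
Proof. exact: sqrtr_ge0. Qed.

Lemma sqr_normv (u : 'rV[R]_3) : normv u ^+ 2 = dotv u u.
Proof. by rewrite sqr_sqrtr// dotvv_ge0. Qed.

(** Lagrange's identity exhibits the defect as a sum of three squares. *)
Lemma dotv_CauchySchwarz (u v : 'rV[R]_3) :
  dotv u v ^+ 2 <= normv u ^+ 2 * normv v ^+ 2.
Proof.
rewrite !sqr_normv !dotvE -subr_ge0.
set x := u 0 _; set y := u 0 _; set z := u 0 _.
set x' := v 0 _; set y' := v 0 _; set z' := v 0 _.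
rewrite (_ : _ - _ = (x * y' - y * x') ^+ 2 + (x * z' - z * x') ^+ 2
  + (y * z' - z * y') ^+ 2); last by ring.
by rewrite !addr_ge0 ?sqr_ge0.
Qed.

Lemma norm_dotv_le (u v : 'rV[R]_3) : `|dotv u v| <= normv u * normv v.
Proof.
rewrite -[leRHS]ger0_norm ?mulr_ge0 ?normv_ge0// -ler_sqr ?nnegrE//.
by rewrite !norm_sqr exprMn dotv_CauchySchwarz.
Qed.

Lemma norm_coord_le q a : `|q 0 a| <= normv q.
Proof.
rewrite -(dotv_delta a q) (le_trans (norm_dotv_le _ _))//.
rewrite (_ : normv (delta_mx 0 a) = 1) ?mul1r//.
by rewrite /normv dotv_delta mxE !eqxx sqrtr1.
Qed.

(** Only the coordinates [a] and [b] move; [c] and [s] stand for the cosine and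
    the sine of the angle. As a sum of [q] and increments along the two axes,
    its inner products expand by linearity. *)
Definition rot a b c s q : 'rV[R]_3 :=
  q + ((c - 1) * q 0 a - s * q 0 b) *: delta_mx 0 a
    + (s * q 0 a + (c - 1) * q 0 b) *: delta_mx 0 b.

(** The classical factorization of a plane rotation into three shears, whose
    ratio [s / (1 + c)] is the tangent of the half angle. *)
Lemma rot_shears a b c s q : a != b -> c ^+ 2 + s ^+ 2 = 1 -> 1 + c != 0 ->
  rot a b c s q = shear a b (- (s / (1 + c)))
    (shear b a s (shear a b (- (s / (1 + c))) q)).
Proof.
move=> ab cs1 c1; apply/rowP => i.
have ba : (b == a) = false by rewrite eq_sym (negbTE ab).
have sE : s ^+ 2 = (1 - c) * (1 + c) by rewrite -[s ^+ 2](addKr (c ^+ 2)) cs1; ring.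
rewrite /rot /shear !mxE !eqxx ba /= !mulr1 !mulr0 !addr0.
set X := q 0 a; set Y := q 0 b; set Q := q 0 i.
have h1 : s * (s / (1 + c)) = 1 - c by rewrite mulrA -expr2 sE mulfK.
set T := s / (1 + c) in h1 *.
have h2 : T * (1 + c) = s by rewrite /T mulfVK.
have h1X : X * (s * T) = X * (1 - c) by rewrite h1.
have h1Y : Y * (s * T) = Y * (1 - c) by rewrite h1.
have h1T : Y * T * (s * T) = Y * T * (1 - c) by rewrite h1.
have h2Y : Y * (T * (1 + c)) = Y * s by rewrite h2.
case: (i == a); case: (i == b); rewrite /= ?mulr1 ?mulr0 ?addr0.
all: lra.
Qed.

Lemma preserves_rot a b c s : a != b -> c ^+ 2 + s ^+ 2 = 1 -> 1 + c != 0 ->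
  preserves mu3 (unvec \o rot a b c s \o vec).
Proof.
move=> ab cs1 c1; have ba : b != a by rewrite eq_sym.
have -> : unvec \o rot a b c s \o vec =
    (unvec \o shear a b (- (s / (1 + c))) \o vec) \o
    ((unvec \o shear b a s \o vec) \o
     (unvec \o shear a b (- (s / (1 + c))) \o vec)).
  by apply/funext => p /=; rewrite !unvecK rot_shears.
by do 2?apply: preserves_comp; exact: preserves_shear.
Qed.

Lemma normv_rot a b c s q : a != b -> c ^+ 2 + s ^+ 2 = 1 ->
  normv (rot a b c s q) = normv q.
Proof.
move=> ab cs1; congr Num.sqrt.
have ba : (b == a) = false by rewrite eq_sym (negbTE ab).
rewrite /rot !(dotvDl, dotvDr, dotvZl, dotvZr, dotv_delta) !(dotvC _ (delta_mx _ _)).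
rewrite !dotv_delta !mxE !eqxx (negbTE ab) ba/=.
set X := q 0 a; set Y := q 0 b; set Q := dotv q q.
apply/eqP; rewrite -subr_eq0 (_ : _ - _ = (c ^+ 2 + s ^+ 2 - 1) * (X ^+ 2 + Y ^+ 2)).
  by rewrite cs1 subrr mul0r.
by ring.
Qed.

Lemma dotv_rot a b c s q u : dotv (rot a b c s q) u = dotv q u
  + (((c - 1) * q 0 a - s * q 0 b) * u 0 a
     + (s * q 0 a + (c - 1) * q 0 b) * u 0 b).
Proof. by rewrite /rot !(dotvDl, dotvZl, dotv_delta) addrA. Qed.

End rotations.

(** * Radial weights *)

Section measurability.
Context {R : realType}.
Local Notation mu1 := (@lebesgue_measure R).
Local Notation mu2 := (sf_product mu1 mu1).
Local Notation mu3 := (sf_product mu2 mu1).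

Lemma measurable_dotv (u : 'rV[R]_3) :
  measurable_fun setT (fun p : R * R * R => dotv (vec p) u).
Proof.
under eq_fun do rewrite dotvE.
by do 2?apply: measurable_funD; apply: measurable_funM => //;
  exact: measurable_coord.
Qed.

Lemma measurable_normv :
  measurable_fun setT (fun p : R * R * R => normv (vec p)).
Proof.
apply: measurableT_comp.
  by apply: continuous_measurable_fun; exact: sqrt_continuous.
under eq_fun do rewrite dotvE.
by do 2?apply: measurable_funD; apply: measurable_funM => //;
  exact: measurable_coord.
Qed.

Lemma measurable_cosT : measurable_fun setT (@cos R).
Proof. apply: continuous_measurable_fun; exact: continuous_cos. Qed.

Lemma measurable_sinT : measurable_fun setT (@sin R).
Proof. apply: continuous_measurable_fun; exact: continuous_sin. Qed.

Lemma measurable_cos_comp d (T : measurableType d) (f : T -> R) :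
  measurable_fun setT f -> measurable_fun setT (fun x => cos (f x)).
Proof. by move=> mf; apply: measurableT_comp => //; exact: measurable_cosT. Qed.

Lemma measurable_sin_comp d (T : measurableType d) (f : T -> R) :
  measurable_fun setT f -> measurable_fun setT (fun x => sin (f x)).
Proof. by move=> mf; apply: measurableT_comp => //; exact: measurable_sinT. Qed.

End measurability.

Lemma integrable_EFinZ d (T : measurableType d) (R : realType)
    (mu : {measure set T -> \bar R}) (D : set T) (k : R) (f : T -> R) :
  measurable D -> mu.-integrable D (EFin \o f) ->
  mu.-integrable D (EFin \o (fun x => k * f x)).
Proof.
by move=> mD intf; apply: eq_integrable (integrableZl mD k intf).
Qed.

Lemma integrable_EFinB d (T : measurableType d) (R : realType)
    (mu : {measure set T -> \bar R}) (D : set T) (f1 f2 : T -> R) :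
  measurable D -> mu.-integrable D (EFin \o f1) ->
  mu.-integrable D (EFin \o f2) ->
  mu.-integrable D (EFin \o (fun x => f1 x - f2 x)).
Proof.
by move=> mD if1 if2; apply: eq_integrable (integrableB mD if1 if2).
Qed.

Lemma integrable_EFinD d (T : measurableType d) (R : realType)
    (mu : {measure set T -> \bar R}) (D : set T) (f1 f2 : T -> R) :
  measurable D -> mu.-integrable D (EFin \o f1) ->
  mu.-integrable D (EFin \o f2) ->
  mu.-integrable D (EFin \o (fun x => f1 x + f2 x)).
Proof.
by move=> mD if1 if2; apply: eq_integrable (integrableD mD if1 if2).
Qed.

Section radial_weight.
Context {R : realType}.
Local Notation mu1 := (@lebesgue_measure R).
Local Notation mu2 := (sf_product mu1 mu1).
Local Notation mu3 := (sf_product mu2 mu1).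
Variables (G : R -> R) (rho : R).
Let g (p : R * R * R) := G (normv (vec p)).
Let N (p : R * R * R) := normv (vec p).

(** A weight [G |q|] supported in the ball of radius [rho]. Only [G |q| * |q|] is
    integrable: for the exponent [-3] the weight itself is not, and it is always
    paired with functions that are [O(|q|)]. *)
Definition admissible_weight :=
  [/\ measurable_fun setT G, forall r, 0 <= G r,
      forall r, G r != 0 -> r <= rho
    & mu3.-integrable setT (fun p => (g p * N p)%:E)].

Hypothesis Gw : admissible_weight.

Lemma measurable_weight : measurable_fun setT g.
Proof. by case: Gw => mG _ _ _; apply: measurableT_comp mG measurable_normv. Qed.

Lemma weight_mul_le (K : R) (C : R) p : (N p <= rho -> `|K| <= C * N p) ->
  `|g p * K| <= C * (g p * N p).
Proof.
case: Gw => _ G0 Grho _ KC; rewrite normrM (ger0_norm (G0 _ : 0 <= g p)) mulrCA.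
have [->|g0] := eqVneq (g p) 0; first by rewrite !mul0r.
by rewrite ler_wpM2l ?G0// KC// Grho.
Qed.

Lemma integrable_weight (K : R * R * R -> R) (C : R) :
  measurable_fun setT K -> (forall p, N p <= rho -> `|K p| <= C * N p) ->
  mu3.-integrable setT (fun p => (g p * K p)%:E).
Proof.
move=> mK KC; case: (Gw) => _ _ _ ig.
apply: (@le_integrable _ _ _ mu3 setT _ _ (fun p => (C * (g p * N p))%:E)) => //.
- by apply/measurable_EFinP; apply: measurable_funM => //; exact: measurable_weight.
- move=> p _ /=; rewrite lee_fin (le_trans (weight_mul_le (KC p)))//.
  exact: ler_norm.
- exact: integrable_EFinZ ig.
Qed.

Lemma Rintegral_weight_le (K : R * R * R -> R) (C : R) :
  measurable_fun setT K -> (forall p, N p <= rho -> `|K p| <= C * N p) ->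
  `|\int[mu3]_p (g p * K p)| <= C * \int[mu3]_p (g p * N p).
Proof.
move=> mK KC; case: (Gw) => _ _ _ ig.
have iK := integrable_weight mK KC.
rewrite (le_trans (le_normr_Rintegral _ iK))// -RintegralZl//.
apply: le_Rintegral => //.
- exact: integrable_norm iK.
- exact: integrable_EFinZ ig.
- by move=> p _; exact: weight_mul_le (KC p).
Qed.

End radial_weight.

(** * Rotation invariance in differential form *)

Section rotation_identity.
Context {R : realType}.
Local Notation mu1 := (@lebesgue_measure R).
Local Notation mu2 := (sf_product mu1 mu1).
Local Notation mu3 := (sf_product mu2 mu1).

Lemma ler_normM (x y A B : R) : `|x| <= A -> `|y| <= B -> `|x * y| <= A * B.
Proof. by move=> xA yB; rewrite normrM ler_pM. Qed.

(** Let [(X, Y)] be two coordinates of [q], rotated by an angle of sine [s], in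
    the function [q_a * cos (q . m + k)]. The remainder of its first-order
    expansion in [s] is [O(s^2 |q|)], the order that the weight can absorb. *)
Lemma rotated_wave_taylor (X Y N rho ma mb M u c s : R) :
  `|X| <= N -> `|Y| <= N -> N <= rho -> `|ma| <= M -> `|mb| <= M ->
  0 <= s <= 1 -> 0 <= 1 - c <= s ^+ 2 ->
  `|(c * X - s * Y) *
      cos (u + (((c - 1) * X - s * Y) * ma + (s * X + (c - 1) * Y) * mb))
    - X * cos u - s * (- Y * cos u - X * (X * mb - Y * ma) * sin u)|
  <= s ^+ 2 * ((1 + 6 * (M * rho) + 32 * (M * rho) ^+ 2) * N).
Proof.
move=> XN YN Nrho maM mbM /andP[s0 s1] /andP[c0 c1].
have N0 : 0 <= N by exact: le_trans XN.
have M0 : 0 <= M by exact: le_trans maM.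
have cs : `|c - 1| <= s ^+ 2 by rewrite distrC ger0_norm.
have ss : s ^+ 2 <= s by rewrite expr2 ler_piMr.
have sE : `|s| <= s by rewrite ger0_norm.
set d := _ * ma + _ * mb.
have dle : `|d| <= 4 * (s * (M * N)).
  have A : `|((c - 1) * X - s * Y) * ma| <= (s * N + s * N) * M.
    apply: ler_normM maM; rewrite (le_trans (ler_normB _ _))//.
    rewrite lerD ?ler_normM//; exact: le_trans cs ss.
  have B : `|(s * X + (c - 1) * Y) * mb| <= (s * N + s * N) * M.
    apply: ler_normM mbM; rewrite (le_trans (ler_normD _ _))//.
    rewrite lerD ?ler_normM//; exact: le_trans cs ss.
  rewrite (le_trans (ler_normD _ _))// (le_trans (lerD A B))//.
  by rewrite le_eqVlt; apply/orP; left; apply/eqP; ring.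
have dle' : `|d| <= 4 * s * (M * rho).
  by rewrite (le_trans dle)// -mulrA !ler_wpM2l.
(* The first-order parts of the cosine and of [d] are subtracted; each of the
   four terms left contains [1 - c], [s * d] or [d ^+ 2], hence is [O(s^2)]. *)
rewrite (_ : _ - _ = (c - 1) * X * cos (u + d)
  + (- (s * Y)) * (cos (u + d) - cos u)
  + X * (cos (u + d) - cos u + d * sin u)
  + (- (c - 1)) * (X * (X * ma + Y * mb) * sin u)); last by rewrite /d; ring.
have T1 : `|(c - 1) * X * cos (u + d)| <= s ^+ 2 * N * 1.
  by rewrite ler_normM ?cos_max// ler_normM.
have T2 : `|(- (s * Y)) * (cos (u + d) - cos u)| <= (s * N) * (4 * s * (M * rho)).
  rewrite ler_normM ?normrN ?ler_normM//.
  by rewrite (le_trans (norm_cosD_sub_le _ _)).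
have T3 : `|X * (cos (u + d) - cos u + d * sin u)|
    <= N * (2 * (4 * s * (M * rho)) ^+ 2).
  rewrite ler_normM// (le_trans (norm_cosD_taylor _ _))// ler_wpM2l//.
  by rewrite -norm_sqr lerXn2r// ?nnegrE// (le_trans _ dle').
have T4 : `|(- (c - 1)) * (X * (X * ma + Y * mb) * sin u)|
    <= s ^+ 2 * (N * (rho * M + rho * M) * 1).
  rewrite ler_normM ?normrN// ler_normM ?sin_max// ler_normM//.
  rewrite (le_trans (ler_normD _ _))// lerD// ler_normM//.
    exact: le_trans XN _.
  exact: le_trans YN _.
rewrite (le_trans (ler_normD _ _))// (le_trans (lerD (ler_normD _ _) (lexx _)))//.
rewrite (le_trans (lerD (lerD (ler_normD _ _) (lexx _)) (lexx _)))//.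
rewrite (le_trans (lerD (lerD (lerD T1 T2) T3) T4))//.
by rewrite le_eqVlt; apply/orP; left; apply/eqP; ring.
Qed.

Variables (G : R -> R) (rho : R).
Hypothesis Gw : admissible_weight G rho.
Let g (p : R * R * R) := G (normv (vec p)).

(** The derivative of [q_a * cos (q . m + k)] along the infinitesimal rotation
    in the plane of the axes [a] and [b]. *)
Definition wave_angular_derivative (a b : 'I_3) (m : 'rV[R]_3) (k : R)
    (q : 'rV[R]_3) : R :=
  - q 0 b * cos (dotv q m + k)
  - q 0 a * (q 0 a * m 0 b - q 0 b * m 0 a) * sin (dotv q m + k).

Lemma measurable_angular_derivative (a b : 'I_3) (m : 'rV[R]_3) (k : R) :
  measurable_fun setT
    (fun p : R * R * R => wave_angular_derivative a b m k (vec p)).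
Proof.
have mdot : measurable_fun setT (fun p : R * R * R => dotv (vec p) m + k).
  by apply: measurable_funD => //; exact: measurable_dotv.
have mc i : measurable_fun setT (fun p : R * R * R => vec p 0 i).
  exact: measurable_coord.
apply: measurable_funB.
  apply: measurable_funM; last exact: measurable_cos_comp.
  exact: measurableT_comp.
apply: measurable_funM; last exact: measurable_sin_comp.
apply: measurable_funM; first exact: mc.
by apply: measurable_funB; apply: measurable_funM.
Qed.

Lemma angular_derivative_le (a b : 'I_3) (m : 'rV[R]_3) (k : R) (q : 'rV[R]_3) :
  normv q <= rho -> `|wave_angular_derivative a b m k q| <=
    (1 + 2 * (rho * normv m)) * normv q.
Proof.
move=> qrho; rewrite /wave_angular_derivative.
have coordle i : `|q 0 i| <= rho by rewrite (le_trans (norm_coord_le _ _)).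
rewrite (le_trans (ler_normB _ _))// mulrDl lerD//.
  by rewrite mulrC ler_normM ?cos_max ?normrN ?norm_coord_le.
rewrite (_ : 2 * _ * _ =
  normv q * (rho * normv m + rho * normv m) * 1); last by ring.
rewrite ler_normM ?sin_max// ler_normM ?norm_coord_le//.
by rewrite (le_trans (ler_normB _ _))// lerD// ler_normM ?norm_coord_le.
Qed.

Lemma integrable_angular_derivative (a b : 'I_3) (m : 'rV[R]_3) (k : R) :
  mu3.-integrable setT
    (EFin \o (fun p => g p * wave_angular_derivative a b m k (vec p))).
Proof.
apply: (integrable_weight Gw (measurable_angular_derivative a b m k)) => p.
exact: angular_derivative_le.
Qed.

(** The weighted integral of [q_a * cos (q . m + k)] is constant along rotations,
    so its derivative vanishes. Instead of differentiating under the integral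
    sign, the first-order expansion is integrated: it bounds the integral of
    the derivative by a multiple of [s] for every small [s]. *)
Lemma Rintegral_angular_derivative (a b : 'I_3) (m : 'rV[R]_3) (k : R) :
  a != b ->
  \int[mu3]_p (g p * wave_angular_derivative a b m k (vec p)) = 0.
Proof.
move=> ab.
pose f (q : 'rV[R]_3) := q 0 a * cos (dotv q m + k).
pose L := wave_angular_derivative a b m k.
pose M := normv m.
pose C := 1 + 6 * (M * rho) + 32 * (M * rho) ^+ 2.
pose I := \int[mu3]_p (g p * normv (vec p)).
have mdot : measurable_fun setT (fun p : R * R * R => dotv (vec p) m + k).
  by apply: measurable_funD => //; exact: measurable_dotv.
have mf : measurable_fun setT (fun p : R * R * R => f (vec p)).
  by apply: measurable_funM; [exact: measurable_coord|exact: measurable_cos_comp].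
have mL : measurable_fun setT (fun p : R * R * R => L (vec p)).
  exact: measurable_angular_derivative.
have bound s : 0 < s -> s <= 1 ->
    `|\int[mu3]_p (g p * L (vec p))| <= s * (C * I).
  move=> s0 s1.
  pose c := Num.sqrt (1 - s ^+ 2).
  have cs1 : c ^+ 2 + s ^+ 2 = 1.
    rewrite sqr_sqrtr ?subrK// subr_ge0 expr_le1//; exact: ltW.
  have c0 : 0 <= c by exact: sqrtr_ge0.
  have c1 : 0 <= 1 - c <= s ^+ 2.
    have : c <= 1 by rewrite -(sqrtr1 R) ler_wsqrtr// gerBl sqr_ge0.
    nra.
  have c1n0 : 1 + c != 0 by rewrite gt_eqF// ltr_wpDr.
  pose T := unvec \o rot a b c s \o @vec R.
  have vT p : vec (T p) = rot a b c s (vec p) by rewrite /T/= unvecK.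
  have NT p : normv (vec (T p)) = normv (vec p) by rewrite vT normv_rot.
  have Tmu : preserves mu3 T by exact: preserves_rot.
  have rem p : normv (vec p) <= rho ->
      `|f (vec (T p)) - f (vec p) - s * L (vec p)| <= s ^+ 2 * C * normv (vec p).
    move=> prho; rewrite vT /f dotv_rot (addrAC (dotv (vec p) m)).
    have -> : rot a b c s (vec p) 0 a = c * vec p 0 a - s * vec p 0 b.
      by rewrite /rot !mxE !eqxx (negbTE ab)/= mulr1 mulr0; ring.
    rewrite -mulrA; apply: rotated_wave_taylor => //; rewrite ?norm_coord_le//.
    by rewrite ltW.
  have fle q : `|f q| <= 1 * normv q.
    by rewrite mulrC ler_normM ?cos_max ?norm_coord_le.
  have mfT : measurable_fun setT (fun p : R * R * R => f (vec (T p))).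
    exact: (measurableT_comp mf Tmu.1).
  have if_ := integrable_weight Gw mf (fun p _ => fle (vec p)).
  have ifT : mu3.-integrable setT (fun p => (g p * f (vec (T p)))%:E).
    apply: (integrable_weight Gw mfT (C := 1)) => p _.
    by rewrite -(NT p) fle.
  have iL := integrable_angular_derivative a b m k.
  have inv : \int[mu3]_p (g p * f (vec (T p))) = \int[mu3]_p (g p * f (vec p)).
    have mgf : measurable_fun setT (fun p : R * R * R => g p * f (vec p)).
      by apply: measurable_funM mf; exact: measurable_weight Gw.
    rewrite -(Rintegral_preserves Tmu mgf); apply: eq_Rintegral => p _.
    by rewrite /g NT.
  have mrem : measurable_fun setT
      (fun p : R * R * R => f (vec (T p)) - f (vec p) - s * L (vec p)).
    by apply: measurable_funB; [exact: measurable_funB|exact: measurable_funM].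
  have := Rintegral_weight_le Gw mrem rem.
  have -> : \int[mu3]_p (g p * (f (vec (T p)) - f (vec p) - s * L (vec p))) =
      - (s * \int[mu3]_p (g p * L (vec p))).
    transitivity (\int[mu3]_p (g p * f (vec (T p)) - g p * f (vec p)
        - s * (g p * L (vec p)))).
      apply: eq_Rintegral => p _; move: (L _) => x; ring.
    have ifTf := integrable_EFinB measurableT ifT if_.
    have isL := integrable_EFinZ s measurableT iL.
    rewrite (RintegralB measurableT ifTf isL).
    rewrite (RintegralB measurableT ifT if_) (RintegralZl s measurableT iL).
    by rewrite inv subrr sub0r.
  rewrite normrN normrM gtr0_norm// expr2 -!mulrA ler_pM2l//.
set J := \int[mu3]_p _ in bound *.
apply/eqP/negPn/negP => J0.
have J1 : `|J| <= C * I by have := bound 1 ltr01 (lexx _); rewrite mul1r.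
have JJ : 0 < `|J| by rewrite normr_gt0.
have K0 : 0 < C * I by exact: lt_le_trans J1.
move: (C * I) => K in bound J1 K0 *.
have s0 : 0 < `|J| / (2 * K) by rewrite divr_gt0// mulr_gt0.
have := bound _ s0; rewrite ler_pdivrMr ?mulr_gt0// mul1r.
have -> : `|J| / (2 * K) * K = `|J| / 2 by field; rewrite gt_eqF.
by move=> H; have := H ltac:(lra); lra.
Qed.

End rotation_identity.

(** * Integrability of the weight |q| `^ gamma *)

Section power_singularity.
Context {R : realType}.
Local Notation mu1 := (@lebesgue_measure R).

(** The bound does not depend on [a], so that [a] may tend to [0]. *)
Lemma integral_powR_away (r : R) (a b : R) : 0 < a -> a < b -> - 1 < r ->
  (\int[mu1]_(x in `[a, b]) (x `^ r)%:E <= ((r + 1)^-1 * b `^ (r + 1))%:E)%E.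
Proof.
move=> a0 ab r1.
have r10 : 0 < r + 1 by rewrite -ltrBlDr sub0r.
pose F x := (r + 1)^-1 * x `^ (r + 1).
have dF (x : R) : 0 < x -> is_derive x 1 F (x `^ r).
  move=> x0; have := is_derive1_powR (r + 1) x0.
  rewrite addrK => /(@is_deriveZ _ _ _ _ (r + 1)^-1).
  by rewrite scalerA mulVf ?scale1r ?gt_eqF//.
have cF (x : R) : 0 < x -> {for x, continuous F}.
  move=> x0; apply: differentiable_continuous; apply/derivable1_diffP.
  by have [] := dF x x0.
rewrite (@continuous_FTC2 _ _ F)//.
- by rewrite lee_fin lerBlDr lerDl mulr_ge0// ?powR_ge0// invr_ge0 ltW.
- apply: continuous_in_subspaceT => x; rewrite inE/= in_itv/= => /andP[ax _].
  have x0 := lt_le_trans a0 ax.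
  apply: differentiable_continuous; apply/derivable1_diffP.
  by have [] := is_derive1_powR r x0.
- split => [x /[!in_itv]/= /andP[ax _]||].
  + by have [] := dF x (lt_trans a0 ax).
  + by apply: cvg_at_right_filter; exact: cF.
  + by apply: cvg_at_left_filter; apply: cF; exact: lt_trans ab.
- move=> x /[!in_itv]/= /andP[ax _].
  by rewrite derive1E; have [_ ->] := dF x (lt_trans a0 ax).
Qed.

Lemma integrable_powR_near0 (r rho : R) : 0 < rho -> - 1 < r ->
  mu1.-integrable `]0, rho] (fun x => (x `^ r)%:E).
Proof.
move=> rho0 r1.
have mpow : measurable_fun setT (fun x : R => (x `^ r)%:E).
  by apply/measurable_EFinP; exact: measurable_powR.
apply/integrableP; split; first exact: measurable_funTS.
under eq_integral do rewrite gee0_abs ?lee_fin ?powR_ge0//.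
pose F n := `[rho / n.+2%:R, rho]%classic.
have -> : `]0, rho]%classic = \bigcup_n F n.
  apply/seteqP; split => [x /=|x [n _]]; rewrite /F/= !in_itv/=.
    move=> /andP[x0 xrho].
    have [n nx] : exists n : nat, rho / x <= n%:R.
      by exists (Num.truncn (rho / x)).+1; rewrite ltW// truncnS_gt.
    exists n => //=; rewrite in_itv/= xrho andbT ler_pdivrMr// mulrC.
    rewrite -ler_pdivrMr// (le_trans nx)// ler_nat.
    by rewrite -addn2 leq_addr.
  by move=> /andP[nx ->]; rewrite andbT (lt_le_trans _ nx)// divr_gt0.
have Fhomo : {homo F : n m / (n <= m)%N >-> (n <= m)%O}.
  move=> n m nm; apply/subsetPset => x; rewrite /F/= !in_itv/= => /andP[nx ->].
  rewrite andbT (le_trans _ nx)// ler_pM2l// lef_pV2 ?posrE//.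
  by rewrite ler_nat !ltnS.
have cvgF := @ge0_nondecreasing_set_cvg_integral _ (measurableTypeR R) R F
  (fun x => (x `^ r)%:E) mu1 Fhomo (fun n => measurable_itv _)
  (fun n => measurable_funTS mpow) (fun n x _ => powR_ge0 x r).
apply: (@le_lt_trans _ _ ((r + 1)^-1 * rho `^ (r + 1))%:E); last exact: ltry.
rewrite -(cvg_lim _ cvgF)//; apply: lime_le; first by apply/cvg_ex; eexists; exact: cvgF.
apply: nearW => n; apply: integral_powR_away => //.
  by rewrite divr_gt0.
by rewrite ltr_pdivrMr// ltr_pMr// ltr1n.
Qed.

Lemma preserves_opp : preserves mu1 (-%R : R -> R).
Proof. by split=> // A mA; exact: (@lebesgue_measureN R A mA). Qed.

(** Integrable majorant of [|x| `^ r] on [[-rho, rho]] away from [0]. *)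
Definition power_majorant (r rho x : R) : R :=
  (fun x => x `^ r) \_ `]0, rho]%classic x
  + (fun x => x `^ r) \_ `]0, rho]%classic (- x).

Lemma integrable_power_majorant (r rho : R) : 0 < rho -> - 1 < r ->
  mu1.-integrable setT (fun x => (power_majorant r rho x)%:E).
Proof.
move=> rho0 r1.
pose f := (fun x => x `^ r) \_ `]0, rho]%classic.
have f0 x : 0 <= f x by rewrite /f patchE; case: ifP => // _; exact: powR_ge0.
have if_ : mu1.-integrable setT (EFin \o f).
  rewrite /f -restrict_EFin; apply/integrable_restrict => //.
  by rewrite setTI; exact: integrable_powR_near0.
apply: (@integrable_EFinD _ (measurableTypeR R) R mu1 setT f (f \o -%R)) => //.
have /integrableP[mf foo] := if_.
apply/integrableP; split.
  exact: (measurableT_comp mf preserves_opp.1).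
apply: le_lt_trans foo; rewrite le_eqVlt; apply/orP; left; apply/eqP.
rewrite -[RHS](ge0_integral_preserves preserves_opp)//.
exact: measurableT_comp.
Qed.

Lemma power_majorant_ge0 (r rho x : R) : 0 <= power_majorant r rho x.
Proof.
by rewrite /power_majorant addr_ge0// patchE; case: ifP => // _; exact: powR_ge0.
Qed.

Lemma power_majorantP (r rho x : R) : x != 0 -> `|x| <= rho ->
  `|x| `^ r <= power_majorant r rho x.
Proof.
move=> x0 xrho; rewrite /power_majorant.
pose f := (fun x => x `^ r) \_ `]0, rho]%classic.
have f0 y : 0 <= f y by rewrite /f patchE; case: ifP => // _; exact: powR_ge0.
have fE y : 0 < y -> y <= rho -> f y = y `^ r.
  by move=> y0 yrho; rewrite /f patchE mem_set//= in_itv/= y0.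
rewrite -/(f x) -/(f (- x)).
case: (ltgtP x 0) xrho => [xn|xp|x00]; last by rewrite x00 eqxx in x0.
- by rewrite ltr0_norm// => xrho; rewrite -fE ?oppr_gt0// lerDr.
- by rewrite gtr0_norm// => xrho; rewrite -fE// lerDl.
Qed.

End power_singularity.

Section integrable_product.
Context d1 d2 (T1 : measurableType d1) (T2 : measurableType d2) (R : realType).
Variable m1 : {sigma_finite_measure set T1 -> \bar R}.
Variable m2 : {sigma_finite_measure set T2 -> \bar R}.

Lemma integrable_product (f : T1 -> R) (h : T2 -> R) :
  m1.-integrable setT (EFin \o f) -> m2.-integrable setT (EFin \o h) ->
  (sf_product m1 m2).-integrable setT (fun p => (f p.1 * h p.2)%:E).
Proof.
move=> intf inth.
have mf : measurable_fun setT f by apply/measurable_EFinP/(measurable_int m1).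
have mh : measurable_fun setT h by apply/measurable_EFinP/(measurable_int m2).
have mfh : measurable_fun setT (fun p : T1 * T2 => (f p.1 * h p.2)%:E).
  by apply/measurable_EFinP/measurable_funM; apply: measurableT_comp.
apply/(integrable12ltyP m1 m2 mfh).
have absf := integrable_norm intf.
have absh := integrable_norm inth.
under eq_integral => x _.
  under eq_integral => y _ do rewrite /= normrM EFinM.
  rewrite (integralZl measurableT absh).
  over.
rewrite -(fineK (integrable_fin_num measurableT absh)).
under eq_integral do rewrite muleC.
rewrite (integralZl measurableT absf).
by rewrite -(fineK (integrable_fin_num measurableT absf)) ltry.
Qed.

End integrable_product.

Section radial_power_weight.
Context {R : realType}.
Local Notation mu1 := (@lebesgue_measure R).
Local Notation mu2 := (sf_product mu1 mu1).
Local Notation mu3 := (sf_product mu2 mu1).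

Lemma sf_product_nulll d1 d2 (T1 : measurableType d1) (T2 : measurableType d2)
    (m1 : {sigma_finite_measure set T1 -> \bar R})
    (m2 : {sigma_finite_measure set T2 -> \bar R}) (A : set T1) :
  measurable A -> m1 A = 0%E -> sf_product m1 m2 (A `*` setT) = 0%E.
Proof.
move=> mA A0; apply: (etrans (product_measure1E m1 m2 mA measurableT)).
transitivity (0 * m2 setT)%E; last exact: mul0e.
by congr (_ * _)%E; exact: A0.
Qed.

Lemma sf_product_nullr d1 d2 (T1 : measurableType d1) (T2 : measurableType d2)
    (m1 : {sigma_finite_measure set T1 -> \bar R})
    (m2 : {sigma_finite_measure set T2 -> \bar R}) (B : set T2) :
  measurable B -> m2 B = 0%E -> sf_product m1 m2 (setT `*` B) = 0%E.
Proof.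
move=> mB B0; apply: (etrans (product_measure1E m1 m2 measurableT mB)).
transitivity (m1 setT * 0)%E; last exact: mule0.
by congr (_ * _)%E; exact: B0.
Qed.

(** The coordinate planes are null sets: they are products with a null factor. *)
Lemma ae_coord_neq0 (i : 'I_3) : {ae mu3, forall p, vec p 0 i != 0}.
Proof.
have null1 : mu1 [set 0] = 0%E by exact: lebesgue_measure_set1.
have m0 : measurable ([set 0] : set (measurableTypeR R)) by exact: measurable_set1.
have m0T : measurable ([set 0] `*` setT : set (measurableTypeR R * measurableTypeR R)).
  exact: (measurableX m0 measurableT).
have mT0 : measurable (setT `*` [set 0] : set (measurableTypeR R * measurableTypeR R)).
  exact: (measurableX measurableT m0).
have n0T : mu2 ([set 0] `*` setT) = 0%E.
  exact: (@sf_product_nulll _ _ _ _ mu1 mu1 _ m0 null1).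
have nT0 : mu2 (setT `*` [set 0]) = 0%E.
  exact: (@sf_product_nullr _ _ _ _ mu1 mu1 _ m0 null1).
have E : mu3 ((fun p => vec p 0 i) @^-1` [set 0]) = 0%E.
  elim/ord3P: i.
  - have -> : (fun p : R * R * R => vec p 0 (inord 0)) @^-1` [set 0] =
      ([set 0] `*` setT) `*` setT.
      by apply/seteqP; split => -[[x y] z] /=; rewrite vecE/=; intuition.
    exact: (@sf_product_nulll _ _ _ _ mu2 mu1 _ m0T n0T).
  - have -> : (fun p : R * R * R => vec p 0 (inord 1)) @^-1` [set 0] =
      (setT `*` [set 0]) `*` setT.
      by apply/seteqP; split => -[[x y] z] /=; rewrite vecE/=; intuition.
    exact: (@sf_product_nulll _ _ _ _ mu2 mu1 _ mT0 nT0).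
  - have -> : (fun p : R * R * R => vec p 0 (inord 2)) @^-1` [set 0] = setT `*` [set 0].
      by apply/seteqP; split => -[[x y] z] /=; rewrite vecE/=; intuition.
    exact: (@sf_product_nullr _ _ _ _ mu2 mu1 _ m0 null1).
exists ((fun p => vec p 0 i) @^-1` [set 0]); split => //.
  by rewrite -[X in measurable X]setTI; exact: measurable_coord.
by move=> p /= /negP; rewrite negbK => /eqP.
Qed.

(** [0 `^ gamma] is [0] or [1], a finite value at the origin, where all functions
    paired with the weight vanish. *)
Definition radial_power (gamma rho r : R) : R :=
  if r <= rho then r `^ gamma else 0.

(** The worst case is [|q|^-2], and
    [|q|^-2 <= |x|^(-2/3) * |y|^(-2/3) * |z|^(-2/3)] off the coordinate planes:
    a product of integrable functions of one variable. *)
Lemma admissible_radial_power (gamma rho : R) : 0 < rho -> -3 <= gamma ->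
  admissible_weight (radial_power gamma rho) rho.
Proof.
move=> rho0 gamma3.
have G0 r : 0 <= radial_power gamma rho r.
  by rewrite /radial_power; case: ifP => // _; exact: powR_ge0.
have mG : measurable_fun setT (radial_power gamma rho).
  apply: (@measurable_fun_ifT _ _ R R (fun r => r `^ gamma) (cst 0)
    (fun r => r <= rho)).
  - exact: measurable_fun_ler.
  - exact: (measurable_powR gamma).
  - exact: measurable_cst.
split=> // [r|].
  by rewrite /radial_power; case: ifP => //; rewrite eqxx.
pose psi := power_majorant (- (2 / 3)) rho.
have ipsi : mu1.-integrable setT (EFin \o psi).
  apply: integrable_power_majorant => //; lra.
have iPsi := integrable_EFinZ (rho `^ (gamma + 3)) measurableT
  (integrable_product (integrable_product ipsi ipsi) ipsi).
have /integrableP[mPsi Psioo] := iPsi.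
have mgN : measurable_fun setT (fun p : R * R * R =>
    radial_power gamma rho (normv (vec p)) * normv (vec p)).
  apply: measurable_funM; last exact: measurable_normv.
  exact: (measurableT_comp mG measurable_normv).
apply/integrableP; split; first exact/measurable_EFinP.
apply: le_lt_trans Psioo.
apply: ae_ge0_le_integral => //.
- by apply: measurableT_comp => //; exact/measurable_EFinP.
- exact: measurableT_comp.
have := ae_coord_neq0 (inord 0); have := ae_coord_neq0 (inord 1).
have := ae_coord_neq0 (inord 2).
apply: (@filterS3 _ _ (ae_filter_ringOfSetsType mu3)) => p.
rewrite !vecE => z0 y0 x0 _ /=.
set N := normv (vec p).
have N0 : 0 < N.
  by rewrite (lt_le_trans _ (norm_coord_le (vec p) (inord 0)))// vec0 normr_gt0.
have Psi0 : 0 <= rho `^ (gamma + 3) * (psi p.1.1 * psi p.1.2 * psi p.2).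
  by rewrite !mulr_ge0 ?power_majorant_ge0 ?powR_ge0.
rewrite lee_fin (ger0_norm Psi0) ger0_norm ?mulr_ge0 ?(ltW N0)//.
rewrite /radial_power; case: ifPn => Nrho; last first.
  by rewrite mul0r.
have cle i : vec p 0 i != 0 -> N `^ (- (2 / 3)) <= psi (vec p 0 i).
  move=> i0; have iN := norm_coord_le (vec p) i.
  apply: le_trans (power_majorantP _ i0 (le_trans iN Nrho)).
  rewrite !powRN lef_pV2 ?posrE ?powR_gt0 ?normr_gt0//.
  by apply: ge0_ler_powR; rewrite ?nnegrE// ltW.
(* [gamma + 3 >= 0]: the factor left after extracting [N^-2] is bounded. *)
have -> : N `^ gamma * N =
    N `^ (gamma + 3) * (N `^ (- (2 / 3)) * N `^ (- (2 / 3)) * N `^ (- (2 / 3))).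
  have Nn (a b : R) : (a + b == 0) ==> (N != 0) by rewrite (gt_eqF N0) implybT.
  by rewrite -[X in _ * X = _](powRr1 (ltW N0)) -!powRD//; congr (_ `^ _); field.
rewrite ler_pM ?mulr_ge0 ?powR_ge0//.
  by apply: ge0_ler_powR; rewrite ?nnegrE ?(ltW N0) ?(ltW rho0)//; lra.
rewrite -(vec0 p) -(vec1 p) -(vec2 p).
by rewrite ler_pM ?mulr_ge0 ?powR_ge0// ?ler_pM ?powR_ge0// cle ?vecE.
Qed.

End radial_power_weight.

(** * Integrals over a period *)

Section periodic_functions.
Context {R : realType}.
Local Notation mu1 := (@lebesgue_measure R).

Lemma integrable_continuous_itv (F : R -> R) (a b : R) : continuous F ->
  mu1.-integrable `[a, b] (EFin \o F).
Proof.
move=> cF; apply: continuous_compact_integrable; first exact: segment_compact.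
exact: continuous_subspaceT.
Qed.

Lemma Rintegral_itv_translate (F : R -> R) (a b d : R) : continuous F ->
  \int[mu1]_(x in `[a, b]) F (x + d) = \int[mu1]_(x in `[a + d, b + d]) F x.
Proof.
move=> cF; rewrite Rintegral_mkcond [RHS]Rintegral_mkcond.
have mF : measurable_fun setT (F \_ `[a + d, b + d]%classic).
  apply/(measurable_restrictT _ _).1 => //.
  by apply: measurable_funTS; exact: continuous_measurable_fun.
rewrite -(Rintegral_preserves (preserves_translation d) mF).
apply: eq_Rintegral => x _; rewrite !patchE; congr (if _ then _ else _).
by apply/idP/idP; rewrite !inE/= !in_itv/= !lerD2r.
Qed.

(** A shift by [d] moves the piece [[0, d]] to the other end of the period. *)
Lemma Rintegral_periodic_shift (F : R -> R) (d : R) : continuous F ->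
  (forall x, F (x + 2 * pi) = F x) -> `|d| <= 2 * pi ->
  \int[mu1]_(x in `[0, 2 * pi]) F (x + d) = \int[mu1]_(x in `[0, 2 * pi]) F x.
Proof.
move=> cF pF.
have pos e : 0 <= e -> e <= 2 * pi ->
    \int[mu1]_(x in `[0, 2 * pi]) F (x + e) = \int[mu1]_(x in `[0, 2 * pi]) F x.
  move=> e0 e2; rewrite Rintegral_itv_translate// add0r.
  have split a b x : a <= x -> x <= b -> \int[mu1]_(t in `[a, b]) F t =
      \int[mu1]_(t in `[a, x]) F t + \int[mu1]_(t in `[x, b]) F t.
    move=> ax xb; apply/eqP; rewrite addrC -subr_eq; apply/eqP.
    rewrite Rintegral_itvB ?bnd_simp//; last exact: integrable_continuous_itv.
    rewrite Rintegral_itv_obnd_cbnd//.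
    apply: integrableS (integrable_continuous_itv x b cF) => //.
    by apply: subset_itvr; rewrite bnd_simp.
  rewrite (split e (2 * pi + e) (2 * pi))// ?lerDl// (split 0 (2 * pi) e)//.
  rewrite addrC; congr (_ + _).
  have := @Rintegral_itv_translate F 0 e (2 * pi) cF.
  rewrite add0r (addrC e) => <-.
  by apply: eq_Rintegral => x _; rewrite pF.
case: (lerP 0 d) => d0; first by rewrite ger0_norm//; exact: pos.
rewrite ltr0_norm// => d2.
rewrite -(pos (d + 2 * pi)) ?addrA//; [|lra|lra].
by apply: eq_Rintegral => x _; rewrite addrA pF.
Qed.

Lemma cosD_2pi (x : R) : cos (x + 2 * pi) = cos x.
Proof. by rewrite mulr_natl cosD2pi. Qed.

End periodic_functions.

Section bessel.
Context {R : realType}.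
Local Notation mu1 := (@lebesgue_measure R).
Implicit Types (z a d : R).

(** This is [2 pi J_0(z)], with [J_0] the Bessel function. *)
Definition bessel (z : R) : R :=
  \int[mu1]_(phi in `[0, 2 * pi]) cos (z * cos phi).

Lemma continuous_wave (f : R -> R) z : continuous f ->
  continuous (fun phi : R => f (z * cos phi)).
Proof.
move=> cf phi; apply: continuous_comp; last exact: cf.
by apply: cvgM; [exact: cvg_cst|exact: continuous_cos].
Qed.

Lemma mu1_0_2pi : fine (mu1 (`[0, 2 * pi] : set R)) = 2 * pi.
Proof.
by rewrite lebesgue_measure_itv/= lte_fin mulr_gt0 ?pi_gt0//= subr0.
Qed.

Lemma norm_Rintegral_0_2pi_le (f : R -> R) (C : R) : continuous f ->
  (forall x, `|f x| <= C) ->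
  `|\int[mu1]_(x in `[0, 2 * pi]) f x| <= C * (2 * pi).
Proof.
move=> cf fC.
have -> : C * (2 * pi) = \int[mu1]_(x in `[0, 2 * pi]) C.
  by rewrite Rintegral_cst// mu1_0_2pi.
have if_ := @integrable_continuous_itv R f 0 (2 * pi) cf.
rewrite (le_trans (le_normr_Rintegral _ if_))//.
apply: le_Rintegral => //; first exact: integrable_norm if_.
by apply: integrable_continuous_itv; exact: cst_continuous.
Qed.

Lemma Rintegral_wave (f : R -> R) (z d : R) : continuous f -> `|d| <= 2 * pi ->
  \int[mu1]_(phi in `[0, 2 * pi]) f (z * cos (phi + d)) =
  \int[mu1]_(phi in `[0, 2 * pi]) f (z * cos phi).
Proof.
move=> cf d2.
have cw : continuous (fun phi : R => f (z * cos phi)).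
  exact: continuous_wave.
rewrite (Rintegral_periodic_shift (F := fun phi => f (z * cos phi)))//.
by move=> x; rewrite cosD_2pi.
Qed.

(** A half-period shift changes the sign of the integrand. *)
Lemma Rintegral_sin_wave z :
  \int[mu1]_(phi in `[0, 2 * pi]) sin (z * cos phi) = 0.
Proof.
set I := (LHS).
have is_ : mu1.-integrable `[0, 2 * pi] (EFin \o (fun phi : R => sin (z * cos phi))).
  by apply: integrable_continuous_itv; apply: continuous_wave; exact: continuous_sin.
have pi2 : `|pi : R| <= 2 * pi by rewrite ger0_norm ?pi_ge0//; have := pi_ge0 R; lra.
have : I = - I.
  rewrite -[LHS](@Rintegral_wave sin z pi)//; last exact: continuous_sin.
  rewrite -mulN1r -RintegralZl//.
  by apply: eq_Rintegral => x _; rewrite cosDpi mulrN sinN mulN1r.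
lra.
Qed.

(** The sine part of the wave has mean zero. *)
Lemma Rintegral_cos_phase (z d a : R) : `|d| <= 2 * pi ->
  \int[mu1]_(phi in `[0, 2 * pi]) cos (a - z * cos (phi + d)) =
  cos a * bessel z.
Proof.
move=> d2.
have ca : continuous (fun x : R => cos (a - x)).
  move=> x; apply: continuous_comp; last exact: continuous_cos.
  by apply: cvgB; [exact: cvg_cst|exact: cvg_id].
rewrite (@Rintegral_wave (fun x => cos (a - x)))//.
have ic : mu1.-integrable `[0, 2 * pi] (EFin \o (fun phi : R => cos (z * cos phi))).
  apply: integrable_continuous_itv.
  by apply: continuous_wave; exact: continuous_cos.
have is_ : mu1.-integrable `[0, 2 * pi] (EFin \o (fun phi : R => sin (z * cos phi))).
  apply: integrable_continuous_itv.
  by apply: continuous_wave; exact: continuous_sin.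
under eq_Rintegral do rewrite cosB.
rewrite RintegralD//; [|exact: integrable_EFinZ|exact: integrable_EFinZ].
by rewrite !RintegralZl// Rintegral_sin_wave mulr0 addr0.
Qed.

Lemma Rintegral_sin_phase (z d a : R) : `|d| <= 2 * pi ->
  \int[mu1]_(phi in `[0, 2 * pi]) sin (a - z * cos (phi + d)) =
  sin a * bessel z.
Proof.
move=> d2; rewrite -cosBpihalf -(Rintegral_cos_phase z (a - pi / 2) d2).
by apply: eq_Rintegral => phi _; rewrite addrAC cosBpihalf.
Qed.

Lemma norm_bessel_le z : `|bessel z| <= 2 * pi.
Proof.
rewrite -[leRHS]mul1r; apply: norm_Rintegral_0_2pi_le; last by move=> x; exact: cos_max.
by apply: continuous_wave; exact: continuous_cos.
Qed.

(** A quarter-period shift exchanges the two squares, which sum to [1]. *)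
Lemma Rintegral_cos2 : \int[mu1]_(phi in `[0, 2 * pi]) (cos phi ^+ 2) = pi :> R.
Proof.
have cc : continuous (fun x : R => cos x ^+ 2).
  by move=> x; apply: (@continuous_comp _ _ _ cos (fun y : R => y ^+ 2));
     [exact: continuous_cos|exact: exprn_continuous].
have cs : continuous (fun x : R => sin x ^+ 2).
  by move=> x; apply: (@continuous_comp _ _ _ sin (fun y : R => y ^+ 2));
     [exact: continuous_sin|exact: exprn_continuous].
set I := (LHS).
have : I + I = 2 * pi.
  rewrite {2}/I -(Rintegral_periodic_shift (d := pi / 2) cc); last 2 first.
  - by move=> x; rewrite cosD_2pi.
  - by rewrite ger0_norm ?divr_ge0 ?pi_ge0//; have := pi_ge0 R; lra.
  rewrite -RintegralD//; last 2 first.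
  - exact: integrable_continuous_itv.
  - apply: (@integrable_continuous_itv _ (fun x : R => cos (x + pi / 2) ^+ 2)).
    by under eq_fun do rewrite cosDpihalf sqrrN.
  under eq_Rintegral do rewrite cosDpihalf sqrrN cos2Dsin2.
  by rewrite Rintegral_cst// mu1_0_2pi mul1r.
lra.
Qed.

(** Integrate the expansion of the cosine, whose quadratic term has mean
    [z^2 / 4]. *)
Lemma bessel_taylor z : `|bessel z - 2 * pi + pi * z ^+ 2 / 2| <= 2 * pi * z ^+ 4.
Proof.
have cz : continuous (fun x : R => cos (z * cos x)).
  by apply: continuous_wave; exact: continuous_cos.
have cc : continuous (fun x : R => cos x ^+ 2).
  by move=> x; apply: (@continuous_comp _ _ _ cos (fun y : R => y ^+ 2));
     [exact: continuous_cos|exact: exprn_continuous].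
have c1 : continuous (cst 1 : R -> R) by exact: cst_continuous.
have ic := @integrable_continuous_itv R _ 0 (2 * pi) cc.
have iz := @integrable_continuous_itv R _ 0 (2 * pi) cz.
have i1 := @integrable_continuous_itv R _ 0 (2 * pi) c1.
have -> : bessel z - 2 * pi + pi * z ^+ 2 / 2 =
    \int[mu1]_(x in `[0, 2 * pi])
      (cos (z * cos x) - 1 + z ^+ 2 / 2 * cos x ^+ 2).
  rewrite RintegralD//; [|exact: integrable_EFinB|exact: integrable_EFinZ].
  rewrite RintegralB// RintegralZl// Rintegral_cst// mu1_0_2pi Rintegral_cos2.
  by rewrite mul1r -/(bessel z); field.
rewrite (mulrC _ (z ^+ 4)); apply: norm_Rintegral_0_2pi_le.
  move=> x; apply: cvgD; first by apply: cvgB; [exact: cz|exact: cvg_cst].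
  by apply: cvgM; [exact: cvg_cst|exact: cc].
move=> x; have := norm_cos_taylor4 (z * cos x).
rewrite !exprMn mulrAC => /le_trans; apply.
by rewrite ler_piMr ?exprn_even_ge0//.
Qed.

Lemma bessel_lipschitz z w : `|bessel z - bessel w| <= 2 * pi * `|z - w|.
Proof.
have cz u : continuous (fun x : R => cos (u * cos x)).
  by apply: continuous_wave; exact: continuous_cos.
rewrite -RintegralB//; [|exact: integrable_continuous_itv..].
rewrite (mulrC _ `|z - w|); apply: norm_Rintegral_0_2pi_le.
  by move=> x; apply: cvgB; exact: cz.
move=> x.
have -> : z * cos x = w * cos x + (z - w) * cos x by ring.
rewrite (le_trans (norm_cosD_sub_le _ _))// normrM ler_piMr//.
exact: cos_max.
Qed.

Lemma continuous_bessel : continuous bessel.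
Proof.
move=> z; apply/cvgrPdist_le => e e0.
near=> w.
rewrite (le_trans (bessel_lipschitz _ _))// mulrC -ler_pdivlMr ?mulr_gt0 ?pi_gt0//.
near: w; apply: cvgr_dist_le; first exact: cvg_id.
by rewrite divr_gt0// mulr_gt0// pi_gt0.
Unshelve. all: end_near. Qed.

(** The point [(Q, P) / V] of the unit circle has an angle [d]. *)
Lemma harmonic_addition (P Q : R) : exists2 d, `|d| <= 2 * pi &
  forall phi, P * sin phi + Q * cos phi =
              Num.sqrt (P ^+ 2 + Q ^+ 2) * cos (phi + d).
Proof.
set V := Num.sqrt _.
have V2 : V ^+ 2 = P ^+ 2 + Q ^+ 2 by rewrite sqr_sqrtr// addr_ge0 ?sqr_ge0.
have [V0|V0] := eqVneq V 0.
  exists 0; first by rewrite normr0 mulr_ge0 ?pi_ge0.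
  move: V2; rewrite V0 expr0n/= => /esym/eqP.
  rewrite paddr_eq0 ?sqr_ge0// !sqrf_eq0 => /andP[/eqP-> /eqP->] phi.
  by rewrite !mul0r addr0.
have Vp : 0 < V by rewrite lt_neqAle eq_sym V0 sqrtr_ge0.
have QV : -1 <= Q / V <= 1.
  rewrite -ler_norml normrM normfV (gtr0_norm Vp) ler_pdivrMr// mul1r.
  by rewrite -[leRHS](gtr0_norm Vp) -ler_sqr ?nnegrE// !norm_sqr V2 lerDr sqr_ge0.
pose t := acos (Q / V).
have ct : V * cos t = Q by rewrite acosK// mulrC mulfVK.
have st : (V * sin t) ^+ 2 = P ^+ 2.
  by rewrite exprMn sin2cos2 mulrBr mulr1 -exprMn ct V2 addrK.
have tpi : `|t| <= 2 * pi.
  rewrite ger0_norm ?acos_ge0// (le_trans (acos_lepi QV))//.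
  by rewrite ler_peMl ?pi_ge0// ler1n.
have /eqP := st; rewrite eqf_sqr => /orP[] /eqP sE.
- exists (- t); first by rewrite normrN.
  by move=> phi; rewrite cosD cosN sinN -ct -sE; ring.
- exists t => // phi; rewrite cosD -ct -[P]opprK -sE; ring.
Qed.

End bessel.

(** * Second-order expansion in the deflection angle *)

Section scattered_wave.
Context {R : realType}.
Local Notation mu1 := (@lebesgue_measure R).
Local Notation mu2 := (sf_product mu1 mu1).
Local Notation mu3 := (sf_product mu2 mu1).

(** With [a = v . q] and [c = |q|^2 |v|^2 - (v . q)^2], this is the integral over
    the azimuth of the real part of
    [exp (i u) * (exp (i v . (q - |q| sigma)) - 1)], [sigma] having colatitude
    [theta]: the azimuth only enters through a Bessel function. *)
Definition scattered_wave (u a c theta : R) : R :=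
  cos (u + (1 - cos theta) * a) * bessel (sin theta * Num.sqrt c)
  - 2 * pi * cos u.

(** The real part of [exp (i u) * (i a - c / 2)]. *)
Definition grazing_wave (u a c : R) : R := - a * sin u - c / 2 * cos u.

Lemma sin2_one_sub_cos (theta : R) :
  sin theta ^+ 2 = (1 - cos theta) * (2 - (1 - cos theta)).
Proof. by rewrite sin2cos2; ring. Qed.

Lemma grazing_wave_le (u a c D : R) : `|a| <= D -> 0 <= c <= D ^+ 2 ->
  `|grazing_wave u a c| <= D * (1 + D).
Proof.
move=> aD /andP[c0 cD]; have D0 : 0 <= D by exact: le_trans aD.
have h1 : `|- a * sin u| <= D * 1 by rewrite ler_normM ?normrN ?sin_max.
have h2 : `|c / 2 * cos u| <= D ^+ 2 * 1.
  rewrite ler_normM ?cos_max// ger0_norm ?divr_ge0//; lra.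
rewrite (le_trans (ler_normB _ _))// (le_trans (lerD h1 h2))//.
by rewrite le_eqVlt; apply/orP; left; apply/eqP; ring.
Qed.

(** The factor of the remainder below, for [|q| |v| <= D]. *)
Definition grazing_constant (D : R) : R :=
  pi * (5 * D + D ^+ 2 + 8 * D ^+ 3 + 8 * D ^+ 4).

(** The azimuthal mean cancels the term of first order in [theta], so what is left
    is of order [w = 1 - cos theta], with a remainder of order [w^2]. That the
    remainder is also [O(X)] keeps it integrable against the weight. *)
Lemma scattered_wave_taylor (u a c theta X D : R) :
  0 <= cos theta -> `|a| <= X -> 0 <= c <= X ^+ 2 -> X <= D ->
  `|scattered_wave u a c theta
    - 2 * pi * (1 - cos theta) * grazing_wave u a c|
  <= grazing_constant D * X * (1 - cos theta) ^+ 2.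
Proof.
move=> ct aX /andP[c0 cX] XD.
have X0 : 0 <= X by exact: le_trans aX.
have D0 : 0 <= D by exact: le_trans XD.
set w := 1 - cos theta.
have w0 : 0 <= w by exact: one_sub_cos_ge0.
have w1 : w <= 1 by rewrite /w; lra.
have cXD : c <= X * D by rewrite (le_trans cX)// expr2 ler_wpM2l.
have cD : c <= D ^+ 2 by rewrite (le_trans cX)// lerXn2r.
pose z := sin theta * Num.sqrt c; pose J := bessel z.
have z2 : z ^+ 2 = w * (2 - w) * c.
  by rewrite /z exprMn sqr_sqrtr// sin2_one_sub_cos.
have z2le : z ^+ 2 <= 2 * w * c.
  by rewrite z2 ler_wpM2r// mulrC ler_wpM2r//; lra.
have z20 : 0 <= z ^+ 2 by exact: sqr_ge0.
have z4le : z ^+ 4 <= 4 * w ^+ 2 * c ^+ 2.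
  rewrite (_ : 4 * _ * _ = (2 * w * c) ^+ 2); last by ring.
  have -> : z ^+ 4 = (z ^+ 2) ^+ 2 by rewrite -exprM.
  by rewrite lerXn2r ?nnegrE// !mulr_ge0.
have pi0 := pi_ge0 R.
have JT : `|J - 2 * pi + pi * z ^+ 2 / 2| <= 2 * pi * (4 * w ^+ 2 * c ^+ 2).
  by rewrite (le_trans (bessel_taylor z))// ler_wpM2l// mulr_ge0.
have J2 : `|J - 2 * pi| <= w * (pi * (8 * D ^+ 4 + D ^+ 2)).
  rewrite (_ : J - 2 * pi = (J - 2 * pi + pi * z ^+ 2 / 2) - pi * z ^+ 2 / 2);
    last by ring.
  rewrite (le_trans (ler_normB _ _))//.
  have A : 2 * pi * (4 * w ^+ 2 * c ^+ 2) <= w * (pi * (8 * D ^+ 4)).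
    rewrite (_ : 2 * _ * _ = 8 * pi * (w ^+ 2 * c ^+ 2)); last by ring.
    rewrite (_ : w * (_) = 8 * pi * (w * (D ^+ 2) ^+ 2)); last by ring.
    rewrite ler_wpM2l ?mulr_ge0// ler_pM ?sqr_ge0//.
      by rewrite expr2 ler_piMr.
    by rewrite lerXn2r ?nnegrE ?sqr_ge0.
  have B : `|pi * z ^+ 2 / 2| <= w * (pi * D ^+ 2).
    rewrite ger0_norm; last by rewrite divr_ge0// mulr_ge0.
    rewrite (_ : w * _ = pi * (2 * w * D ^+ 2) / 2); last by field.
    by rewrite ler_wpM2r// ler_wpM2l// (le_trans z2le)// ler_wpM2l// mulr_ge0.
  rewrite (le_trans (lerD JT (lexx _)))// (le_trans (lerD A B))//.
  by rewrite -mulrDr -mulrDr.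
(* Expand the cosine and the Bessel function separately; since
   [z ^+ 2 = w * (2 - w) * c], replacing [z ^+ 2 / 2] by [w * c] costs the last
   term. *)
rewrite (_ : _ - _ =
    (cos (u + w * a) - cos u + w * a * sin u) * J
    + (- (w * a) * sin u) * (J - 2 * pi)
    + cos u * (J - 2 * pi + pi * z ^+ 2 / 2)
    + pi * c * w ^+ 2 / 2 * cos u); last first.
  by rewrite /scattered_wave /grazing_wave -/w -/z -/J z2; field.
have T1 : `|(cos (u + w * a) - cos u + w * a * sin u) * J| <=
    2 * (w * X) ^+ 2 * (2 * pi).
  rewrite ler_normM ?norm_bessel_le// (le_trans (norm_cosD_taylor _ _))//.
  rewrite ler_wpM2l// -norm_sqr lerXn2r ?nnegrE ?mulr_ge0//.
  by rewrite normrM ger0_norm// ler_wpM2l.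
have T2 : `|(- (w * a) * sin u) * (J - 2 * pi)| <=
    w * X * 1 * (w * (pi * (8 * D ^+ 4 + D ^+ 2))).
  rewrite ler_normM// ler_normM ?sin_max// normrN normrM ger0_norm//.
  by rewrite ler_wpM2l.
have T3 : `|cos u * (J - 2 * pi + pi * z ^+ 2 / 2)| <=
    1 * (2 * pi * (4 * w ^+ 2 * c ^+ 2)) by rewrite ler_normM ?cos_max.
have T4 : `|pi * c * w ^+ 2 / 2 * cos u| <= pi * c * w ^+ 2 / 2 * 1.
  by rewrite ler_normM ?cos_max// ger0_norm// divr_ge0// !mulr_ge0// sqr_ge0.
rewrite (le_trans (ler_normD _ _))// (le_trans (lerD (ler_normD _ _) (lexx _)))//.
rewrite (le_trans (lerD (lerD (ler_normD _ _) (lexx _)) (lexx _)))//.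
rewrite (le_trans (lerD (lerD (lerD T1 T2) T3) T4))//.
have c2 : c ^+ 2 <= X * D * D ^+ 2 by rewrite expr2 ler_pM.
have X2 : X ^+ 2 <= X * D by rewrite expr2 ler_wpM2l.
have pw : 0 <= pi * w ^+ 2 by rewrite mulr_ge0 ?sqr_ge0.
have K1 := ler_wpM2l pw c2; have K2 := ler_wpM2l pw X2.
have K3 := ler_wpM2l pw cXD; rewrite /grazing_constant.
have K4 : 0 <= pi * w ^+ 2 * (X * D) by rewrite !mulr_ge0.
lra.
Qed.

End scattered_wave.

(** * Averages over the deflection angle *)

Section angular_average.
Context {R : realType}.
Local Notation mu1 := (@lebesgue_measure R).
Local Notation mu2 := (sf_product mu1 mu1).
Local Notation mu3 := (sf_product mu2 mu1).

(** [B t] stands for [b (cos t) * sin t]; only its product with [1 - cos t] is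
    integrable. *)
Definition small_angle_density (B : R -> R) : Prop :=
  [/\ measurable_fun setT B, forall t, 0 <= B t,
      forall t, B t != 0 -> 0 <= cos t
    & mu1.-integrable setT (fun t => (B t * (1 - cos t))%:E)].

Variables (G : R -> R) (rho : R) (m v : 'rV[R]_3) (k : R) (B : R -> R).
Hypotheses (rho0 : 0 <= rho) (Gw : admissible_weight G rho).
Hypothesis Bd : small_angle_density B.

Let g (p : R * R * R) := G (normv (vec p)).
Let N (p : R * R * R) := normv (vec p).

Definition phase (q : 'rV[R]_3) : R := dotv q m + k.
Definition longitudinal (q : 'rV[R]_3) : R := dotv v q.
(** [|q|^2] times the squared norm of the part of [v] orthogonal to [q], in a form
    that is polynomial in [q]. *)
Definition transverse2 (q : 'rV[R]_3) : R :=
  normv q ^+ 2 * normv v ^+ 2 - dotv v q ^+ 2.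
Definition scattered (q : 'rV[R]_3) (t : R) : R :=
  scattered_wave (phase q) (longitudinal q) (transverse2 q) t.
Definition grazing (q : 'rV[R]_3) : R :=
  grazing_wave (phase q) (longitudinal q) (transverse2 q).

Let D := normv v * rho.
Let C1 := grazing_constant D * normv v.
Let C2 := 2 * pi * (normv v * (1 + D)) + C1.

Let longitudinal_le q : `|longitudinal q| <= normv v * normv q.
Proof. exact: norm_dotv_le. Qed.

Let transverse2_le q : 0 <= transverse2 q <= (normv v * normv q) ^+ 2.
Proof.
rewrite /transverse2 subr_ge0 mulrC dotv_CauchySchwarz exprMn gerBl.
exact: sqr_ge0.
Qed.

Let XD q : normv q <= rho -> normv v * normv q <= D.
Proof. by move=> qr; rewrite ler_wpM2l ?normv_ge0. Qed.

Let D0 : 0 <= D. Proof. by rewrite mulr_ge0 ?normv_ge0. Qed.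

Let C10 : 0 <= C1.
Proof.
rewrite /C1 mulr_ge0 ?normv_ge0// /grazing_constant mulr_ge0 ?pi_ge0//.
have := exprn_ge0 2 D0; have := exprn_ge0 3 D0; have := exprn_ge0 4 D0.
have := D0; lra.
Qed.

Lemma grazing_le q : normv q <= rho -> `|grazing q| <= normv v * (1 + D) * normv q.
Proof.
move=> qr; rewrite mulrAC.
rewrite (le_trans (grazing_wave_le _ (longitudinal_le q) (transverse2_le q)))//.
by rewrite ler_wpM2l ?mulr_ge0 ?normv_ge0// lerD2l XD.
Qed.

Lemma scattered_taylor q t : normv q <= rho -> 0 <= cos t ->
  `|scattered q t - 2 * pi * (1 - cos t) * grazing q| <= C1 * normv q * (1 - cos t) ^+ 2.
Proof.
move=> qr ct; rewrite /C1 -(mulrA (grazing_constant D)).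
exact: scattered_wave_taylor (longitudinal_le q) (transverse2_le q) (XD qr).
Qed.

Lemma scattered_le q t : normv q <= rho -> 0 <= cos t ->
  `|scattered q t| <= C2 * normv q * (1 - cos t).
Proof.
move=> qr ct.
have w0 := one_sub_cos_ge0 t; set w := 1 - cos t in w0 *.
have w1 : w <= 1 by rewrite /w; lra.
rewrite -[scattered q t](subrK (2 * pi * w * grazing q)) (le_trans (ler_normD _ _))//.
rewrite [X in X <= _]addrC /C2 [X in _ <= X * _]mulrDl [X in _ <= X]mulrDl lerD//.
  have pw : 0 <= 2 * pi * w by rewrite !mulr_ge0 ?pi_ge0.
  rewrite normrM (ger0_norm pw).
  rewrite [X in _ <= X](_ : _ =
    2 * pi * w * (normv v * (1 + D) * normv q)); last by ring.
  by rewrite ler_wpM2l ?grazing_le.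
rewrite (le_trans (scattered_taylor qr ct))//.
rewrite (ler_wpM2l (mulr_ge0 C10 (normv_ge0 q)))// -/w.
by rewrite expr2 ler_piMr.
Qed.

Lemma measurable_phase : measurable_fun setT (fun p : R * R * R => phase (vec p)).
Proof. by apply: measurable_funD => //; exact: measurable_dotv. Qed.

Lemma measurable_longitudinal :
  measurable_fun setT (fun p : R * R * R => longitudinal (vec p)).
Proof.
rewrite /longitudinal; under eq_fun do rewrite dotvC.
exact: measurable_dotv.
Qed.

Lemma measurable_transverse2 :
  measurable_fun setT (fun p : R * R * R => transverse2 (vec p)).
Proof.
have mN := @measurable_normv R.
apply: measurable_funB; last by apply: measurable_funX; exact: measurable_longitudinal.
by apply: measurable_funM => //; exact: measurable_funX.
Qed.

Lemma measurable_grazing : measurable_fun setT (fun p : R * R * R => grazing (vec p)).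
Proof.
apply: measurable_funB; apply: measurable_funM.
- by apply: measurableT_comp => //; exact: measurable_longitudinal.
- by apply: measurable_sin_comp; exact: measurable_phase.
- by apply: measurable_funM => //; exact: measurable_transverse2.
- by apply: measurable_cos_comp; exact: measurable_phase.
Qed.

Lemma measurable_scattered :
  measurable_fun setT (fun z : (R * R * R) * R => scattered (vec z.1) z.2).
Proof.
have m1 (f : R * R * R -> R) : measurable_fun setT f ->
    measurable_fun setT (fun z : (R * R * R) * R => f z.1).
  by move=> mf; apply: (measurableT_comp mf); exact: measurable_fst.
have m2 (f : R -> R) : measurable_fun setT f ->
    measurable_fun setT (fun z : (R * R * R) * R => f z.2).
  by move=> mf; apply: (measurableT_comp mf); exact: measurable_snd.
have mc := @measurable_cosT R; have ms := @measurable_sinT R.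
have mph := m1 _ measurable_phase.
have ml := m1 _ measurable_longitudinal.
have mt := m1 _ measurable_transverse2.
have m2c := m2 _ mc; have m2s := m2 _ ms.
apply: measurable_funB; last first.
  by apply: measurable_funM => //; exact: measurable_cos_comp.
apply: measurable_funM.
  apply: measurable_cos_comp; apply: measurable_funD => //.
  by apply: measurable_funM => //; exact: measurable_funB.
apply: (@measurableT_comp _ _ _ _ _ _ (@bessel R)).
  by apply: continuous_measurable_fun; exact: continuous_bessel.
apply: measurable_funM => //.
apply: (@measurableT_comp _ _ _ _ _ _ (@Num.sqrt R)) => //.
by apply: continuous_measurable_fun; exact: sqrt_continuous.
Qed.

Let L := \int[mu1]_t (B t * (1 - cos t)).
Let M2 := \int[mu1]_t (B t * (1 - cos t) ^+ 2).

Lemma density_mul_le (x y t : R) : (0 <= cos t -> `|x| <= y) ->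
  `|B t * x| <= B t * y.
Proof.
case: Bd => _ B0 Bc _ xy; rewrite normrM ger0_norm//.
have [->|Bt] := eqVneq (B t) 0; first by rewrite !mul0r.
by rewrite ler_wpM2l// xy// Bc.
Qed.

Lemma measurable_densityM (f : R -> R) : measurable_fun setT f ->
  measurable_fun setT (fun t => B t * f t).
Proof. by case: Bd => mB _ _ _ mf; exact: measurable_funM. Qed.

Lemma integrable_density (f : R -> R) (C : R) : measurable_fun setT f ->
  (forall t, 0 <= cos t -> `|f t| <= C * (1 - cos t)) ->
  mu1.-integrable setT (EFin \o (fun t => B t * f t)).
Proof.
move=> mf fC; case: (Bd) => _ _ _ iB.
apply: le_integrable (integrable_EFinZ C measurableT iB) => //.
  by apply/measurable_EFinP; exact: measurable_densityM.
move=> t _ /=; rewrite lee_fin mulrCA.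
by apply: le_trans (ler_norm _); exact: density_mul_le (fC t).
Qed.

Let mw : measurable_fun setT (fun t : R => 1 - cos t).
Proof. by apply: measurable_funB => //; exact: measurable_cosT. Qed.

Lemma integrable_density_sqr :
  mu1.-integrable setT (EFin \o (fun t => B t * (1 - cos t) ^+ 2)).
Proof.
apply: (integrable_density (C := 1)); first exact: measurable_funX.
move=> t ct; rewrite ger0_norm ?sqr_ge0// mul1r expr2 ler_piMr ?one_sub_cos_ge0//.
lra.
Qed.

Lemma measurable_scattered_section p : measurable_fun setT (scattered (vec p)).
Proof. by have := measurableT_comp measurable_scattered (pair1_measurable p). Qed.

Lemma integrable_density_scattered p : N p <= rho ->
  mu1.-integrable setT (EFin \o (fun t => B t * scattered (vec p) t)).
Proof.
move=> pr; apply: integrable_density; first exact: measurable_scattered_section.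
by move=> t ct; exact: scattered_le.
Qed.

Definition mean_scattered (p : R * R * R) : R := \int[mu1]_t (B t * scattered (vec p) t).

Lemma mean_scattered_taylor p : N p <= rho ->
  `|mean_scattered p - 2 * pi * L * grazing (vec p)| <= C1 * M2 * N p.
Proof.
move=> pr; case: (Bd) => _ _ _ iB.
have iS := integrable_density_scattered pr.
have iBg := integrable_EFinZ (2 * pi * grazing (vec p)) measurableT iB.
have iB2 := integrable_EFinZ (C1 * N p) measurableT integrable_density_sqr.
have -> : mean_scattered p - 2 * pi * L * grazing (vec p) =
   \int[mu1]_t (B t * scattered (vec p) t
                - 2 * pi * grazing (vec p) * (B t * (1 - cos t))).
  rewrite (RintegralB measurableT iS iBg) (RintegralZl _ measurableT iB).
  by congr (_ - _); rewrite mulrAC.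
have iD := integrable_EFinB measurableT iS iBg.
rewrite (le_trans (le_normr_Rintegral measurableT iD))//.
rewrite (mulrAC C1) -(RintegralZl _ measurableT integrable_density_sqr).
apply: le_Rintegral => //; first exact: integrable_norm iD.
move=> t _.
rewrite (_ : _ - _ =
  B t * (scattered (vec p) t - 2 * pi * (1 - cos t) * grazing (vec p)));
  last by ring.
by rewrite [leRHS]mulrCA; apply: density_mul_le => ct; exact: scattered_taylor.
Qed.

Lemma mean_scattered_le p : N p <= rho -> `|mean_scattered p| <= C2 * L * N p.
Proof.
move=> pr; case: (Bd) => _ _ _ iB.
have iS := integrable_density_scattered pr.
rewrite (le_trans (le_normr_Rintegral measurableT iS))//.
rewrite (mulrAC C2) -(RintegralZl _ measurableT iB).
apply: le_Rintegral => //; first exact: integrable_norm iS.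
  exact: integrable_EFinZ.
move=> t _; rewrite [leRHS]mulrCA; apply: density_mul_le => ct.
exact: scattered_le.
Qed.

(** Fubini supplies the measurability in [q] of the angular mean. *)
Lemma measurable_mean_scattered :
  measurable_fun setT (fun p : R * R * R => g p * mean_scattered p).
Proof.
case: (Bd) => mB _ _ iB; case: (Gw) => _ G0 Gr ig.
pose H (z : (R * R * R) * R) : R := g z.1 * (B z.2 * scattered (vec z.1) z.2).
have mH : measurable_fun setT H.
  apply: measurable_funM.
    by apply: (measurableT_comp (measurable_weight Gw)); exact: measurable_fst.
  apply: measurable_funM; last exact: measurable_scattered.
  by apply: (measurableT_comp mB); exact: measurable_snd.
have iH : (sf_product mu3 mu1).-integrable setT (EFin \o H).
  have iP := integrable_EFinZ C2 measurableT (integrable_product ig iB).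
  apply: le_integrable iP => //; first exact/measurable_EFinP.
  move=> [p t] _ /=; rewrite lee_fin; apply: le_trans (ler_norm _).
  rewrite /H/= (_ : C2 * _ = G (normv (vec p)) *
    (B t * (C2 * normv (vec p) * (1 - cos t)))); last by rewrite /=; ring.
  rewrite normrM (ger0_norm (G0 _)).
  have [->|g0] := eqVneq (G (normv (vec p))) 0; first by rewrite !mul0r.
  rewrite ler_wpM2l ?G0//; apply: density_mul_le => ct.
  by apply: scattered_le => //; exact: Gr.
have := @measurable_fubini_F _ _ _ _ R mu3 mu1 _ iH.
move=> /(measurableT_comp (fine_measurable measurableT)).
congr (measurable_fun _ _); apply/funext => p.
transitivity (\int[mu1]_t (g p * (B t * scattered (vec p) t))); first by [].
have [g0|g0] := eqVneq (g p) 0.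
  rewrite g0 mul0r; under eq_Rintegral do rewrite mul0r.
  by rewrite Rintegral_cst// mul0r.
by rewrite (RintegralZl _ measurableT (integrable_density_scattered (Gr _ g0))).
Qed.

Lemma integrable_mean_scattered :
  mu3.-integrable setT (EFin \o (fun p => g p * mean_scattered p)).
Proof.
case: (Gw) => _ G0 Gr ig.
apply: le_integrable (integrable_EFinZ (C2 * L) measurableT ig) => //.
  by apply/measurable_EFinP; exact: measurable_mean_scattered.
move=> p _ /=; rewrite lee_fin; apply: le_trans (ler_norm _).
exact: (weight_mul_le Gw (mean_scattered_le (p:=p))).
Qed.

(** The total cross-section multiplies the leading term, and the second moment
    of the angular density controls the error. *)
Lemma Rintegral_mean_scattered_taylor :
  `|\int[mu3]_p (g p * mean_scattered p)
    - 2 * pi * L * \int[mu3]_p (g p * grazing (vec p))|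
  <= C1 * M2 * \int[mu3]_p (g p * N p).
Proof.
case: (Gw) => _ _ _ ig.
have iE := integrable_weight Gw measurable_grazing (fun p => @grazing_le (vec p)).
have iEc := integrable_EFinZ (2 * pi * L) measurableT iE.
have iS := integrable_mean_scattered.
rewrite -(RintegralZl _ measurableT iE) -(RintegralB measurableT iS iEc).
have iD := integrable_EFinB measurableT iS iEc.
rewrite (le_trans (le_normr_Rintegral measurableT iD))//.
rewrite -(RintegralZl _ measurableT ig).
apply: le_Rintegral => //; first exact: integrable_norm iD.
  exact: integrable_EFinZ.
move=> p _; rewrite mulrCA -mulrBr.
exact: (weight_mul_le Gw (mean_scattered_taylor (p:=p))).
Qed.

End angular_average.

(** * Orthonormal frames and the deflected velocity *)

Section frames.
Context {R : realType}.
Implicit Types (q v u j h : 'rV[R]_3) (theta phi : R).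

Lemma normv_eq1 u : normv u = 1 -> dotv u u = 1.
Proof. by move=> u1; rewrite -sqr_normv u1 expr1n. Qed.

Lemma dotv_mulmx (u v : 'rV[R]_3) : dotv u v = (u *m v^T) 0 0.
Proof. by rewrite /dotv mxE; apply: eq_bigr => i _; rewrite mxE. Qed.

(** The matrix of an orthonormal frame is orthogonal, on either side. *)
Lemma Parseval3 u j h v : orthonormal3 u j h ->
  dotv v u ^+ 2 + dotv v j ^+ 2 + dotv v h ^+ 2 = dotv v v.
Proof.
move=> [[/normv_eq1 uu /normv_eq1 jj /normv_eq1 hh] [uj uh jh]].
pose e (i : nat) := [:: u; j; h]`_i.
pose M : 'M[R]_3 := \matrix_(i, k) e i 0 k.
have E (i k : nat) : (i < 3)%N -> (k < 3)%N ->
    ((inord i : 'I_3) == inord k) = (i == k).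
  by move=> i3 k3; rewrite -val_eqE/= !inordK.
have MMT : M *m M^T = 1%:M.
  apply/matrixP => a b.
  have -> : (M *m M^T) a b = dotv (e a) (e b).
    by rewrite mxE; apply: eq_bigr => k _; rewrite !mxE.
  rewrite !mxE; elim/ord3P: a; elim/ord3P: b;
    by rewrite E// /e !inordK//= ?uu ?jj ?hh ?uj ?uh ?jh// dotvC ?uj ?uh ?jh.
have MTM : M^T *m M = 1%:M by exact: mulmx1C.
have -> : dotv v v = dotv (v *m M^T) (v *m M^T).
  by rewrite !dotv_mulmx trmx_mul trmxK mulmxA -(mulmxA v) MTM mulmx1.
have vM i : (v *m M^T) 0 i = dotv v (e i).
  by rewrite mxE; apply: eq_bigr => k _; rewrite !mxE.
by rewrite [in RHS]dotvE !vM /e !inordK//= !expr2.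
Qed.

Lemma dotvBr (u v w : 'rV[R]_3) : dotv u (v - w) = dotv u v - dotv u w.
Proof. by rewrite !dotvE !mxE; ring. Qed.

Lemma dotv_deflection v q j h theta phi :
  dotv v (q - post_relative_velocity q j h theta phi) =
  (1 - cos theta) * dotv v q -
  (normv q * sin theta * dotv v j * sin phi
   + normv q * sin theta * dotv v h * cos phi).
Proof.
rewrite dotvBr /post_relative_velocity !dotvDr !dotvZr; ring.
Qed.

Lemma normv_eq0 q : (normv q == 0) = (q == 0).
Proof.
apply/eqP/eqP => [q0|->].
  apply/rowP => i; rewrite mxE; apply/eqP; rewrite -normr_le0.
  by rewrite (le_trans (norm_coord_le q i))// q0.
by rewrite /normv dotvE !mxE !mul0r !addr0 sqrtr0.
Qed.

Lemma normv0 : normv (0 : 'rV[R]_3) = 0.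
Proof. by apply/eqP; rewrite normv_eq0. Qed.

Lemma dotv0 v : dotv v 0 = 0.
Proof. by rewrite dotvE !mxE !mulr0 !addr0. Qed.

Lemma unitvE q : q != 0 -> normv q *: unitv q = q.
Proof. by move=> q0; rewrite scalerA mulfV ?scale1r// normv_eq0. Qed.

(** By Parseval the two transverse components of [v] do not depend on the frame;
    at [q = 0] both sides are [0]. *)
Lemma transverse_components v q j h theta : (q != 0 -> orthonormal3 (unitv q) j h) ->
  (normv q * sin theta * dotv v j) ^+ 2 + (normv q * sin theta * dotv v h) ^+ 2
  = sin theta ^+ 2 * transverse2 v q.
Proof.
move=> frame; rewrite /transverse2.
have [->|q0] := eqVneq q 0.
  by rewrite normv0 dotv0; ring.
have P := Parseval3 v (frame q0).
rewrite (_ : dotv v q = normv q * dotv v (unitv q)); last first.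
  by rewrite -dotvZr unitvE.
rewrite (sqr_normv v) -P; ring.
Qed.

End frames.

(** * The Boltzmann modes as weighted real integrals *)

Section boltzmann_integrand.
Context {R : realType}.
Local Notation mu1 := (@lebesgue_measure R).
Implicit Types (q v m : 'rV[R]_3) (theta phi : R).

Lemma complex_ReM (x y : R[i]) : complex.Re (x * y) =
  complex.Re x * complex.Re y - complex.Im x * complex.Im y.
Proof. by case: x => a b; case: y => c d. Qed.

Lemma complex_ImM (x y : R[i]) : complex.Im (x * y) =
  complex.Re x * complex.Im y + complex.Im x * complex.Re y.
Proof. by case: x => a b; case: y => c d. Qed.

Lemma complex_ReB1 (x : R[i]) : complex.Re (x - 1) = complex.Re x - 1.
Proof. by case: x. Qed.

Lemma complex_ImB1 (x : R[i]) : complex.Im (x - 1) = complex.Im x.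
Proof. by case: x => a b /=; rewrite oppr0 addr0. Qed.

(** The harmonic addition formula turns the phase into a single cosine with a
    phase shift, which disappears in the integral over a period. *)
Lemma azimuthal_integral v q j h theta (c : R) :
  (q != 0 -> orthonormal3 (unitv q) j h) -> 0 <= sin theta ->
  Cintegral mu1 `[0, 2 * pi] (fun phi => c%:C%C *
    (expi (dotv v (q - post_relative_velocity q j h theta phi)) - 1)) =
  Complex (c * scattered_wave 0 (longitudinal v q) (transverse2 v q) theta)
          (c * scattered_wave (- (pi / 2)) (longitudinal v q) (transverse2 v q) theta).
Proof.
move=> frame s0.
have [d d2 hd] := harmonic_addition (normv q * sin theta * dotv v j)
  (normv q * sin theta * dotv v h).
rewrite (transverse_components v theta frame) in hd.
rewrite sqrtrM ?sqr_ge0// sqrtr_sqr ger0_norm// in hd.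
set z := sin theta * Num.sqrt (transverse2 v q) in hd.
set w := (1 - cos theta) * longitudinal v q.
have yE phi : dotv v (q - post_relative_velocity q j h theta phi) =
    w - z * cos (phi + d) by rewrite dotv_deflection hd.
have cy : continuous (fun phi : R => w - z * cos (phi + d)).
  move=> phi; apply: cvgB; first exact: cvg_cst.
  apply: cvgM; first exact: cvg_cst.
  apply: (@continuous_comp _ _ _ (fun x : R => x + d) cos).
    by apply: cvgD; [exact: cvg_id|exact: cvg_cst].
  exact: continuous_cos.
have ic : mu1.-integrable `[0, 2 * pi]
    (EFin \o (fun phi : R => cos (w - z * cos (phi + d)))).
  apply: integrable_continuous_itv => x.
  by apply: (continuous_comp (cy x)); exact: continuous_cos.
have is_ : mu1.-integrable `[0, 2 * pi]
    (EFin \o (fun phi : R => sin (w - z * cos (phi + d)))).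
  apply: integrable_continuous_itv => x.
  by apply: (continuous_comp (cy x)); exact: continuous_sin.
have i1 : mu1.-integrable `[0, 2 * pi] (EFin \o (fun _ : R => 1 : R)).
  by apply: integrable_continuous_itv => x; exact: cvg_cst.
have mD : measurable (`[0, 2 * pi]%classic : set (measurableTypeR R)).
  exact: measurable_itv.
rewrite /Cintegral; congr Complex.
- transitivity (\int[mu1]_(phi in `[0, 2 * pi])
      (c * (cos (w - z * cos (phi + d)) - 1))).
    by apply: eq_Rintegral => phi _; rewrite complex_ReM complex_ReB1 /= mul0r subr0 yE.
  have icB := integrable_EFinB mD ic i1.
  rewrite (RintegralZl _ mD icB).
  rewrite (RintegralB mD ic i1) Rintegral_cos_phase//.
  rewrite Rintegral_cst// mu1_0_2pi mul1r /scattered_wave -/z -/w.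
  by rewrite add0r cos0 mulr1.
- transitivity (\int[mu1]_(phi in `[0, 2 * pi])
      (c * sin (w - z * cos (phi + d)))).
    by apply: eq_Rintegral => phi _; rewrite complex_ImM complex_ImB1 /= mul0r addr0 yE.
  rewrite (RintegralZl _ mD is_) Rintegral_sin_phase//.
  rewrite /scattered_wave -/z -/w cosN cos_pihalf mulr0 subr0.
  by rewrite addrC cosBpihalf.
Qed.

Lemma scattered_wave_phase (u x a c theta : R) :
  scattered_wave (x + u) a c theta =
  cos x * scattered_wave u a c theta - sin x * scattered_wave (u - pi / 2) a c theta.
Proof.
rewrite /scattered_wave (addrAC u) !cosBpihalf -addrA !cosD; ring.
Qed.

(** Cutting off outside [`]0, pi / 2]] removes [t = 0], where [b] is arbitrary. *)
Definition angular_density (b : R -> R) : R -> R :=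
  (fun t => b (cos t) * sin t) \_ `]0, pi / 2]%classic.

(** At [t = 0] the sine vanishes, and beyond [pi / 2] so does [b]. *)
Lemma angular_densityE (b : R -> R) (t : R) : angular_function b ->
  t \in `[0, pi] -> b (cos t) * sin t = angular_density b t.
Proof.
move=> [_ _ b0]; rewrite in_itv/= => /andP[t0 tpi].
rewrite /angular_density patchE; case: ifPn => //.
rewrite notin_setE/= in_itv/= => /negP; rewrite negb_and -!leNgt => /orP[t00|].
  by rewrite (_ : t = 0) ?sin0 ?mulr0//; apply/eqP; rewrite eq_le t00.
by rewrite -ltNge => t2; rewrite b0 ?mul0r// in_itv/= t2.
Qed.

Lemma angular_density0 (b : R -> R) (t : R) : t \notin `[0, pi] ->
  angular_density b t = 0.
Proof.
rewrite /angular_density patchE in_itv/= => tpi; case: ifPn => //.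
rewrite inE/= in_itv/= => /andP[t0 t2]; move: tpi; rewrite (ltW t0)/=.
by rewrite (le_trans t2)// ler_pdivrMr// ler_peMr ?pi_ge0// ler1n.
Qed.

Lemma polar_Rintegral (gamma : R) (b : R -> R) q (S : R -> R) :
  angular_function b ->
  mu1.-integrable setT (EFin \o (fun t => angular_density b t * S t)) ->
  \int[mu1]_(t in `[0, pi])
    (variable_collision_kernel gamma b q t * sin t * S t) =
  normv q `^ gamma * \int[mu1]_t (angular_density b t * S t).
Proof.
move=> bang iBS; rewrite Rintegral_mkcond -(RintegralZl _ measurableT iBS).
apply: eq_Rintegral => t _; rewrite patchE; case: ifPn.
  rewrite inE/= => tpi; rewrite /variable_collision_kernel.
  by rewrite -(angular_densityE bang tpi) !mulrA.
by rewrite notin_setE/= => /negP tpi; rewrite angular_density0// mul0r mulr0.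
Qed.

Lemma polar_integral (gamma rho : R) (b : R -> R) v j h (p : R * R * R) :
  (vec p != 0 -> orthonormal3 (unitv (vec p)) j h) -> 0 <= rho ->
  normv (vec p) <= rho ->
  angular_function b -> small_angle_density (angular_density b) ->
  Cintegral mu1 `[0, pi] (fun t => Cintegral mu1 `[0, 2 * pi] (fun phi =>
    (variable_collision_kernel gamma b (vec p) t * sin t)%:C%C *
    (expi (dotv v (vec p - post_relative_velocity (vec p) j h t phi)) - 1))) =
  Complex (normv (vec p) `^ gamma * mean_scattered 0 v 0 (angular_density b) p)
    (normv (vec p) `^ gamma * mean_scattered 0 v (- (pi / 2)) (angular_density b) p).
Proof.
move=> frame rho0 prho bang Bd.
have E k t : scattered_wave k (longitudinal v (vec p)) (transverse2 v (vec p)) t =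
    scattered 0 v k (vec p) t by rewrite /scattered /phase dotv0 add0r.
have is_ k := integrable_density_scattered 0 v k rho0 Bd prho.
rewrite [LHS]/Cintegral; congr Complex.
- rewrite -(polar_Rintegral gamma (vec p) bang (is_ 0)).
  apply: eq_Rintegral => t tpi; rewrite azimuthal_integral//= ?E//.
  by apply: sin_ge0_pi; move: tpi; rewrite inE/= in_itv.
- rewrite -(polar_Rintegral gamma (vec p) bang (is_ (- (pi / 2)))).
  apply: eq_Rintegral => t tpi; rewrite azimuthal_integral//= ?E//.
  by apply: sin_ge0_pi; move: tpi; rewrite inE/= in_itv.
Qed.

End boltzmann_integrand.

Section boltzmann_modes.
Context {R : realType}.
Local Notation mu1 := (@lebesgue_measure R).
Local Notation mu2 := (sf_product mu1 mu1).
Local Notation mu3 := (sf_product mu2 mu1).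

Lemma scattered_wave_phase_sub (x a c theta : R) :
  scattered_wave (x - pi / 2) a c theta =
  sin x * scattered_wave 0 a c theta
  + cos x * scattered_wave (- (pi / 2)) a c theta.
Proof.
rewrite /scattered_wave addrAC cosBpihalf !add0r cos0 cosBpihalf.
rewrite (addrC (- _)) cosBpihalf cosN cos_pihalf sinD; ring.
Qed.

(** The factor [exp (i q . m)] rotates the pair of real and imaginary parts. *)
Lemma mean_scattered_phase (rho : R) (m v : 'rV[R]_3) (B : R -> R)
    (p : R * R * R) : 0 <= rho -> small_angle_density B ->
  normv (vec p) <= rho ->
  mean_scattered m v 0 B p = cos (dotv (vec p) m) * mean_scattered 0 v 0 B p
    - sin (dotv (vec p) m) * mean_scattered 0 v (- (pi / 2)) B p /\
  mean_scattered m v (- (pi / 2)) B p = sin (dotv (vec p) m) * mean_scattered 0 v 0 B p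
    + cos (dotv (vec p) m) * mean_scattered 0 v (- (pi / 2)) B p.
Proof.
move=> rho0 Bd prho.
have is_ k := integrable_density_scattered 0 v k rho0 Bd prho.
have isC k c := integrable_EFinZ c measurableT (is_ k).
set x := dotv (vec p) m.
have E k t : scattered_wave k (longitudinal v (vec p)) (transverse2 v (vec p)) t =
    scattered 0 v k (vec p) t by rewrite /scattered /phase dotv0 add0r.
split.
- rewrite /mean_scattered -!(RintegralZl _ measurableT (is_ _)).
  rewrite -(RintegralB measurableT (isC _ _) (isC _ _)).
  apply: eq_Rintegral => t _.
  rewrite {1}/scattered /phase -/x scattered_wave_phase !E add0r; ring.
- rewrite /mean_scattered -!(RintegralZl _ measurableT (is_ _)).
  rewrite -(RintegralD measurableT (isC _ _) (isC _ _)).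
  apply: eq_Rintegral => t _.
  rewrite {1}/scattered /phase -/x scattered_wave_phase_sub !E; ring.
Qed.

Lemma lambda_pi_gt0 : 0 < 2 * lambda * pi :> R.
Proof.
rewrite mulr_gt0 ?pi_gt0// mulr_gt0// /lambda divr_gt0// ltr_wpDr// sqrtr_ge0.
Qed.

(** The real and the imaginary part are the same integral with the phase shifted
    by a quarter period. *)
Lemma boltzmann_modeE (gamma : R) (b : R -> R) (j h : 'rV[R]_3 -> 'rV[R]_3)
    (l m : 'rV[int]_3) :
  (forall q, q != 0 -> orthonormal3 (unitv q) (j q) (h q)) ->
  angular_function b -> small_angle_density (angular_density b) ->
  let I k := \int[mu3]_p (radial_power gamma (2 * lambda * pi) (normv (vec p))
    * mean_scattered (freq m) (2^-1 *: freq (l - m)) k (angular_density b) p) in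
  boltzmann_mode j h (variable_collision_kernel gamma b) l m =
  Complex (I 0) (I (- (pi / 2))).
Proof.
move=> frame bang Bd I.
set rho := 2 * lambda * pi in I *.
set v := 2^-1 *: freq (l - m) in I *.
have rho0 : 0 <= rho by rewrite ltW// lambda_pi_gt0.
pose F q := expi (dotv q (freq m)) *
  Cintegral mu1 `[0, pi] (fun theta => Cintegral mu1 `[0, 2 * pi] (fun phi =>
    (variable_collision_kernel gamma b q theta * sin theta)%:C%C *
    (expi (dotv v (q - post_relative_velocity q (j q) (h q) theta phi)) - 1))).
have FE p : normv (vec p) <= rho -> F (vec p) = expi (dotv (vec p) (freq m)) *
    Complex (normv (vec p) `^ gamma * mean_scattered 0 v 0 (angular_density b) p)
      (normv (vec p) `^ gamma *
       mean_scattered 0 v (- (pi / 2)) (angular_density b) p).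
  move=> prho; congr (_ * _).
  exact: polar_integral (frame (vec p)) rho0 prho bang Bd.
have -> : boltzmann_mode j h (variable_collision_kernel gamma b) l m =
    Complex (\int[mu3]_(p in @vec R @^-1` euclidean_ball rho) complex.Re (F (vec p)))
      (\int[mu3]_(p in @vec R @^-1` euclidean_ball rho) complex.Im (F (vec p))).
  by [].
congr Complex.
- transitivity (\int[mu3]_(p in @vec R @^-1` euclidean_ball rho)
    (normv (vec p) `^ gamma * mean_scattered (freq m) v 0 (angular_density b) p)).
    apply: eq_Rintegral => p /set_mem prho.
    have [-> _] := mean_scattered_phase (freq m) v rho0 Bd prho.
    rewrite (FE p prho). rewrite complex_ReM/=; ring.
  rewrite Rintegral_mkcond; apply: eq_Rintegral => p _.
  rewrite patchE /radial_power; case: ifPn; rewrite ?inE ?notin_setE/=.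
    by rewrite /euclidean_ball/= => ->.
  by rewrite /euclidean_ball/= => /negP/negbTE ->; rewrite mul0r.
- transitivity (\int[mu3]_(p in @vec R @^-1` euclidean_ball rho)
    (normv (vec p) `^ gamma *
     mean_scattered (freq m) v (- (pi / 2)) (angular_density b) p)).
    apply: eq_Rintegral => p /set_mem prho.
    have [_ ->] := mean_scattered_phase (freq m) v rho0 Bd prho.
    rewrite (FE p prho) complex_ImM/=; ring.
  rewrite Rintegral_mkcond; apply: eq_Rintegral => p _.
  rewrite patchE /radial_power; case: ifPn; rewrite ?inE ?notin_setE/=.
    by rewrite /euclidean_ball/= => ->.
  by rewrite /euclidean_ball/= => /negP/negbTE ->; rewrite mul0r.
Qed.

End boltzmann_modes.

(** * Families concentrating on grazing collisions *)

Section grazing_densities.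
Context {R : realType}.
Local Notation mu1 := (@lebesgue_measure R).

Lemma pihalf_gt0 : 0 < pi / 2 :> R.
Proof. by rewrite divr_gt0 ?pi_gt0. Qed.

Lemma pihalf_le_pi : pi / 2 <= pi :> R.
Proof. by rewrite ler_pdivrMr// ler_peMr ?pi_ge0// ler1n. Qed.

Lemma angular_density_ge0 (b : R -> R) t : angular_function b ->
  0 <= angular_density b t.
Proof.
move=> [_ b0 _]; rewrite /angular_density patchE; case: ifPn => //.
rewrite inE/= in_itv/= => /andP[t0 t2].
have tpi := le_trans t2 pihalf_le_pi.
rewrite mulr_ge0// ?b0 ?in_itv/= ?t0//.
by rewrite sin_ge0_pi// ltW.
Qed.

Lemma measurable_angular_density (b : R -> R) : angular_function b ->
  measurable_fun setT (angular_density b).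
Proof.
move=> [mb _ _]; apply/(measurable_restrictT _ _).1 => //.
apply: measurable_funM; last by apply: measurable_funTS; exact: measurable_sinT.
apply: (@measurable_comp _ _ _ R R R `[-1, 1[%classic b _ cos) => //; last first.
  by apply: measurable_funTS; exact: measurable_cosT.
move=> _ [t /=] /[!in_itv]/= /andP[t0 t2] <-; rewrite cos_geN1/=.
have tpi := le_trans t2 pihalf_le_pi.
by rewrite -(@cos0 R) ltr_cos// in_itv/= ?lexx ?pi_ge0// (ltW t0).
Qed.

Lemma angular_density_cos_ge0 (b : R -> R) t : angular_density b t != 0 ->
  0 <= cos t.
Proof.
rewrite /angular_density patchE; case: ifPn => //; last by rewrite eqxx.
rewrite inE/= in_itv/= => /andP[t0 t2] _; apply: cos_ge0_pihalf.
by rewrite t2 andbT (le_trans _ (ltW t0))// oppr_le0 ltW// pihalf_gt0.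
Qed.

Lemma integral_angular_density (b : R -> R) : angular_function b ->
  cross_section b =
  ((2 * pi)%:E * \int[mu1]_t (angular_density b t * (1 - cos t))%:E)%E.
Proof.
move=> bang; rewrite /cross_section; congr (_ * _)%E.
rewrite integral_mkcond; apply: eq_integral => t _.
rewrite patchE; case: ifPn.
  rewrite inE/= in_itv/= => /andP[t0 t2].
  rewrite -angular_densityE// ?in_itv/= ?t0 ?(le_trans t2) ?pihalf_le_pi//.
  by rewrite mulrAC.
rewrite notin_setE/= => /negP tn; rewrite /angular_density patchE ifF ?mul0r//.
apply/negbTE; rewrite notin_setE/= => tI; case/negP: tn.
by move: tI; rewrite !in_itv/= => /andP[/ltW-> ->].
Qed.

Lemma small_angle_angular_density (b : R -> R) : angular_function b ->
  cross_section b \is a fin_num -> small_angle_density (angular_density b).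
Proof.
move=> bang bfin; split.
- exact: measurable_angular_density.
- by move=> t; exact: angular_density_ge0.
- by move=> t; exact: angular_density_cos_ge0.
have B0 t : 0 <= angular_density b t * (1 - cos t).
  by rewrite mulr_ge0 ?angular_density_ge0 ?one_sub_cos_ge0.
apply/integrableP; split.
  apply/measurable_EFinP; apply: measurable_funM.
    exact: measurable_angular_density.
  by apply: measurable_funB => //; exact: measurable_cosT.
under eq_integral do rewrite gee0_abs ?lee_fin//.
rewrite ltey; apply/eqP => Ioo.
move: bfin; rewrite integral_angular_density// Ioo gt0_muley//.
by rewrite lte_fin mulr_gt0 ?pi_gt0.
Qed.

Lemma fine_cross_section (b : R -> R) : angular_function b ->
  cross_section b \is a fin_num ->
  fine (cross_section b) =
  2 * pi * \int[mu1]_t (angular_density b t * (1 - cos t)).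
Proof.
move=> bang bfin; have [_ _ _ iB] := small_angle_angular_density bang bfin.
rewrite integral_angular_density// /Rintegral.
by rewrite -[X in (_ * X)%E](fineK (integrable_fin_num measurableT iB)).
Qed.

(** Angles below [t1] contribute little because [1 - cos t] is small there,
    the others because [b] is. *)
Lemma second_moment_le (b : R -> R) (t1 eta : R) : angular_function b ->
  cross_section b \is a fin_num -> 0 < t1 <= 1 ->
  (forall t, t \in `[t1, pi] -> b (cos t) <= eta) ->
  \int[mu1]_t (angular_density b t * (1 - cos t) ^+ 2) <=
  t1 * \int[mu1]_t (angular_density b t * (1 - cos t)) + eta * (pi / 2).
Proof.
move=> bang bfin /andP[t10 t11] beta.
have Bd := small_angle_angular_density bang bfin.
have [_ B0 Bc iB] := Bd.
have eta0 : 0 <= eta.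
  have piI : (pi : R) \in `[t1, pi].
    by rewrite in_itv/= lexx andbT (le_trans t11)// (le_trans _ (pi_ge2 R))// ler1n.
  have [_ b0 _] := bang.
  by rewrite (le_trans _ (beta _ piI))// b0// in_itv/= pi_gt0 lexx.
pose one : R -> R := (fun _ => eta) \_ `[0, pi / 2]%classic.
have ione : mu1.-integrable setT (EFin \o one).
  rewrite /one -restrict_EFin; apply/integrable_restrict => //; rewrite setTI.
  by apply: (@integrable_continuous_itv R (fun _ => eta)) => x; exact: cvg_cst.
have Ione : \int[mu1]_t one t = eta * (pi / 2).
  rewrite -Rintegral_mkcond Rintegral_cst//; congr (_ * _).
  have : fine (mu1 (`[0, pi / 2] : set R)) = pi / 2; last by [].
  by rewrite lebesgue_measure_itv/= lte_fin pihalf_gt0/= subr0.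
rewrite -Ione -(RintegralZl _ measurableT iB).
have itB := integrable_EFinZ t1 measurableT iB.
rewrite -(RintegralD measurableT itB ione).
apply: le_Rintegral => //.
- exact: integrable_density_sqr Bd.
- exact: integrable_EFinD.
move=> t _; have w0 := one_sub_cos_ge0 t.
have one0 : 0 <= one t by rewrite /one patchE; case: ifP.
have [Bt0|Bt0] := eqVneq (angular_density b t) 0.
  by rewrite Bt0 !mul0r mulr0 add0r.
have ct := Bc t Bt0.
have w1 : 1 - cos t <= 1 by lra.
have tI : t \in `]0, pi / 2].
  by move: Bt0; rewrite /angular_density patchE; case: ifPn;
    rewrite ?eqxx// inE.
have /andP[t0 t2] : 0 < t <= pi / 2 by move: tI; rewrite in_itv.
have tpi := le_trans t2 pihalf_le_pi.
have Bw0 : 0 <= angular_density b t * (1 - cos t) by rewrite mulr_ge0.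
case: (leP t1 t) => tt1.
- have -> : one t = eta.
    by rewrite /one patchE mem_set//= in_itv/= t2 ltW.
  rewrite -[X in X <= _]add0r lerD//; first by rewrite mulr_ge0// ltW.
  rewrite -angular_densityE ?in_itv/= ?(ltW t0)//.
  have bt : b (cos t) <= eta by apply: beta; rewrite in_itv/= tt1.
  have b0 : 0 <= b (cos t).
    by have [_ + _] := bang; apply; rewrite in_itv/= t0.
  have s0 : 0 <= sin t by rewrite sin_ge0_pi// (ltW t0).
  rewrite -[eta]mulr1 -[eta * 1]mulr1 ler_pM ?mulr_ge0 ?sqr_ge0//.
    by rewrite ler_pM// sin_le1.
  by rewrite exprn_ile1.
- rewrite -[X in X <= _]addr0 lerD// expr2 mulrCA ler_wpM2r//.
  rewrite (le_trans (one_sub_cos_le t))//.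
  have : t ^+ 2 <= t1 * 1 by rewrite expr2 ler_pM// ltW// (lt_le_trans tt1).
  have := sqr_ge0 t; lra.
Qed.

(** Concentration on grazing collisions kills every moment of order higher than
    the one that defines the cross-section. *)
Lemma second_moment_cvg0 (b : R -> R -> R) (Lambda0 : R) :
  0 <= Lambda0 -> (forall eps, 0 < eps -> angular_function (b eps)) ->
  concentrates_on_grazing b Lambda0 ->
  \int[mu1]_t (angular_density (b eps) t * (1 - cos t) ^+ 2)
    @[eps --> 0^'+] --> (0 : R).
Proof.
move=> L0 bang [/fine_cvgP[bfin bcvg] bunif].
apply/cvgrPdist_le => e e0.
have L1 : 0 < Lambda0 + 1 by rewrite ltr_wpDl.
(* Small angles contribute at most [t1 * (Lambda0 + 1) <= e / 2], the others at
   most [e / 4 * (pi / 2) <= e / 2]. *)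
pose t1 := Num.min 1 (e / (2 * (Lambda0 + 1))).
have t10 : 0 < t1 by rewrite lt_min ltr01 divr_gt0// mulr_gt0.
have t11 : t1 <= 1 by rewrite ge_min lexx.
have t1e : t1 * (Lambda0 + 1) <= e / 2.
  rewrite (@le_trans _ _ (e / (2 * (Lambda0 + 1)) * (Lambda0 + 1)))//.
    by rewrite ler_wpM2r ?(ltW L1)// ge_min lexx orbT.
  by rewrite le_eqVlt; apply/orP; left; apply/eqP; field; rewrite gt_eqF.
have e4 : 0 < e / 4 by rewrite divr_gt0.
have bsmall : \forall eps \near 0^'+, forall t, t \in `[t1, pi] ->
    `|b eps (cos t)| <= e / 4.
  have /= := bunif t1 t10
    [set f : R -> R | forall t, t \in `[t1, pi] -> `|f t| <= e / 4].
  apply; apply/uniform_nbhs.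
  exists [set xy : R * R | ball xy.1 (e / 4) xy.2]; split.
    exact: (entourage_ball _ (PosNum e4)).
  move=> f /= fE t tI; have := fE t tI.
  by rewrite /ball/= sub0r normrN => /ltW.
near=> eps.
have eps0 : 0 < eps by near: eps; exact: nbhs_right_gt.
have bf : cross_section (b eps) \is a fin_num by near: eps.
have Lle : fine (cross_section (b eps)) <= Lambda0 + 1.
  have : `|Lambda0 - fine (cross_section (b eps))| <= 1.
    by near: eps; move/cvgrPdist_le : bcvg; exact.
  by rewrite ler_norml; lra.
have bs : forall t, t \in `[t1, pi] -> `|b eps (cos t)| <= e / 4 by near: eps.
have bang' := bang _ eps0.
have Bd := small_angle_angular_density bang' bf.
have [_ B0 _ _] := Bd.
rewrite sub0r normrN ger0_norm; last first.
  by apply: Rintegral_ge0 => t _; rewrite mulr_ge0// sqr_ge0.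
apply: (le_trans (second_moment_le (t1 := t1) (eta := e / 4) bang' bf _ _)).
- by rewrite t10 t11.
- by move=> t tI; rewrite (le_trans (ler_norm _))// bs.
set L := \int[mu1]_t (_ * (1 - cos t)).
have L_ge0 : 0 <= L.
  by apply: Rintegral_ge0 => t _; rewrite mulr_ge0// one_sub_cos_ge0.
have LL : L <= Lambda0 + 1.
  rewrite (le_trans _ Lle)// fine_cross_section// -/L ler_peMl//.
  by have := pi_ge2 R; lra.
have tL : t1 * L <= t1 * (Lambda0 + 1) by rewrite ler_wpM2l// ltW.
have := pihalf_lt2 R; nra.
Unshelve. all: end_near. Qed.

End grazing_densities.

(** * The tangential divergence identity *)

Section tangential_divergence.
Context {R : realType}.
Local Notation mu1 := (@lebesgue_measure R).
Local Notation mu2 := (sf_product mu1 mu1).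
Local Notation mu3 := (sf_product mu2 mu1).

(** Integrability is part of the notion so that null integrals add up. *)
Definition null_integral (f : R * R * R -> R) : Prop :=
  mu3.-integrable setT (EFin \o f) /\ \int[mu3]_p f p = 0.

Lemma null_integralD f1 f2 : null_integral f1 -> null_integral f2 ->
  null_integral (fun p => f1 p + f2 p).
Proof.
move=> [i1 e1] [i2 e2]; split; first exact: integrable_EFinD.
by rewrite (RintegralD measurableT i1 i2) e1 e2 addr0.
Qed.

Lemma null_integralZ c f : null_integral f -> null_integral (fun p => c * f p).
Proof.
move=> [i1 e1]; split; first exact: integrable_EFinZ.
by rewrite (RintegralZl _ measurableT i1) e1 mulr0.
Qed.

(** The integrand is minus the divergence of a field tangent to the spheres,
    namely [(|q|^2 l - (l . q) q) * cos (q . m + k)]; the flux through spheres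
    vanishes. Algebraically it is a combination, with coefficients [- l_b], of
    the angular derivatives of the functions [q_a * cos (q . m + k)]. *)
Lemma null_integral_tangential_divergence (G : R -> R) (rho : R)
    (l m : 'rV[R]_3) (k : R) : admissible_weight G rho ->
  null_integral (fun p => G (normv (vec p)) *
    (2 * dotv (vec p) l * cos (dotv (vec p) m + k)
     + (normv (vec p) ^+ 2 * dotv l m - dotv (vec p) l * dotv (vec p) m)
       * sin (dotv (vec p) m + k))).
Proof.
move=> Gw.
pose F (a b : nat) p := l 0 (inord b) *
  (G (normv (vec p)) * wave_angular_derivative (inord a) (inord b) m k (vec p)).
have F0 a b : (a < 3)%N -> (b < 3)%N -> a != b -> null_integral (F a b).
  move=> a3 b3 ab; apply: null_integralZ; split.
    exact: integrable_angular_derivative Gw _ _ _ _.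
  apply: (Rintegral_angular_derivative Gw).
  by apply: contraNneq ab => /(congr1 val); rewrite /= !inordK// => /eqP.
have := null_integralZ (-1) (null_integralD (F0 0 1 isT isT isT)%N
  (null_integralD (F0 0 2 isT isT isT)%N (null_integralD (F0 1 0 isT isT isT)%N
  (null_integralD (F0 1 2 isT isT isT)%N (null_integralD (F0 2 0 isT isT isT)%N
  (F0 2 1 isT isT isT)%N))))).
congr null_integral; apply/funext => p.
rewrite /F /wave_angular_derivative sqr_normv.
move: (cos _) (sin _) (G _) => C S g.
rewrite !dotvE; ring.
Qed.

End tangential_divergence.

(** * The Landau modes *)

Section landau_modes.
Context {R : realType}.
Local Notation mu1 := (@lebesgue_measure R).
Local Notation mu2 := (sf_product mu1 mu1).
Local Notation mu3 := (sf_product mu2 mu1).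

Lemma normv_perpv (k q : 'rV[R]_3) :
  normv q ^+ 2 * normv (perpv k q) ^+ 2 = transverse2 k q.
Proof.
have [->|q0] := eqVneq q 0.
  by rewrite /transverse2 normv0 dotv0 !expr0n/= !mul0r subr0.
have uu : dotv (unitv q) (unitv q) = 1.
  by rewrite dotvZl dotvZr -sqr_normv; field; rewrite normv_eq0.
rewrite /transverse2 (_ : dotv k q = normv q * dotv k (unitv q)); last first.
  by rewrite -dotvZr unitvE.
have E (c : R) (w : 'rV[R]_3) : dotv (k - c *: w) (k - c *: w) =
    dotv k k - 2 * c * dotv k w + c ^+ 2 * dotv w w.
  by rewrite !dotvE !mxE; ring.
rewrite (sqr_normv (perpv k q)) (sqr_normv k) /perpv E uu; ring.
Qed.

(** The real part of [exp (i (q . m + kappa))] times the bracket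
    [i q . k + |q|^2 |k_perp|^2 / 4] of the Landau modes. *)
Definition landau_wave (m k : 'rV[R]_3) (kappa : R) (q : 'rV[R]_3) : R :=
  cos (dotv q m + kappa) * (4^-1 * transverse2 k q)
  - sin (dotv q m + kappa) * dotv q k.

(** Passing from [v = (l - m) / 2] to [k = l + m] changes the quadratic and the
    linear term of the wave; the change is a tangential divergence, so it
    disappears after integration. *)
Lemma landau_wave_tangential (l m q : 'rV[R]_3) (kappa : R) :
  landau_wave m (l + m) kappa q =
  2 * dotv q l * cos (dotv q m + (kappa + pi / 2))
    + (normv q ^+ 2 * dotv l m - dotv q l * dotv q m)
       * sin (dotv q m + (kappa + pi / 2))
  - 2 * grazing m (2^-1 *: (l - m)) kappa q.
Proof.
rewrite /landau_wave /grazing /grazing_wave /phase /longitudinal /transverse2.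
rewrite addrA cosDpihalf sinDpihalf !sqr_normv.
by move: (cos _) (sin _) => C S; rewrite !dotvE !mxE; field.
Qed.

Lemma Rintegral_landau_wave (G : R -> R) (rho : R) (l m : 'rV[R]_3)
    (kappa : R) : admissible_weight G rho ->
  mu3.-integrable setT
    (EFin \o (fun p => G (normv (vec p)) * landau_wave m (l + m) kappa (vec p)))
  /\ \int[mu3]_p (G (normv (vec p)) * landau_wave m (l + m) kappa (vec p)) =
  - (2 * \int[mu3]_p (G (normv (vec p)) * grazing m (2^-1 *: (l - m)) kappa (vec p))).
Proof.
move=> Gw.
have [iT T0] := null_integral_tangential_divergence l m (kappa + pi / 2) Gw.
set v := 2^-1 *: (l - m).
have iE : mu3.-integrable setT
    (EFin \o (fun p => G (normv (vec p)) * grazing m v kappa (vec p))).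
  apply: (integrable_weight Gw (measurable_grazing m v kappa)) => p pr.
  exact: (grazing_le (rho := rho)).
have iE2 := integrable_EFinZ 2 measurableT iE.
have E p : G (normv (vec p)) * landau_wave m (l + m) kappa (vec p) =
    G (normv (vec p)) *
    (2 * dotv (vec p) l * cos (dotv (vec p) m + (kappa + pi / 2))
     + (normv (vec p) ^+ 2 * dotv l m - dotv (vec p) l * dotv (vec p) m)
       * sin (dotv (vec p) m + (kappa + pi / 2)))
    - 2 * (G (normv (vec p)) * grazing m v kappa (vec p)).
  by rewrite landau_wave_tangential mulrBr (mulrCA (G _) 2).
rewrite (funext E); split; first exact: integrable_EFinB.
by rewrite (RintegralB measurableT iT iE2) T0 (RintegralZl _ measurableT iE) sub0r.
Qed.

Lemma landau_modeE (gamma Lambda0 : R) (l m : 'rV[int]_3) : -3 <= gamma ->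
  let I k := \int[mu3]_p (radial_power gamma (2 * lambda * pi) (normv (vec p))
    * grazing (freq m) (2^-1 *: freq (l - m)) k (vec p)) in
  landau_mode (fun r => Lambda0 / 8 * r `^ (gamma + 2)) l m =
  Complex (Lambda0 * I 0) (Lambda0 * I (- (pi / 2))).
Proof.
move=> gamma3 I.
set rho := 2 * lambda * pi in I *.
have Gw : admissible_weight (radial_power gamma rho) rho.
  by apply: admissible_radial_power => //; exact: lambda_pi_gt0.
have freqD : freq (l + m) = freq l + freq m :> 'rV[R]_3 by exact: map_mxD.
have freqB : freq (l - m) = freq l - freq m :> 'rV[R]_3 by exact: map_mxB.
set k : 'rV[R]_3 := freq (l + m).
pose psi (q : 'rV[R]_3) : R :=
  Lambda0 / 8 * normv q `^ (gamma + 2) / normv q ^+ 2.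
pose F q := expi (dotv q (freq m)) * (psi q)%:C%C * ('i * (dotv q k)%:C%C
  + (4^-1 * normv q ^+ 2 * normv (perpv k q) ^+ 2)%:C%C).
have psiE kappa q : psi q * landau_wave (freq m) k kappa q =
    Lambda0 / 8 * (normv q `^ gamma * landau_wave (freq m) k kappa q).
  (* At [q = 0] the wave vanishes, whatever value [psi] takes there. *)
  have [->|q0] := eqVneq q 0.
    rewrite (_ : landau_wave _ _ _ _ = 0) ?mulr0//.
    by rewrite /landau_wave /transverse2 normv0 (dotvC _ k) dotv0; ring.
  have N0 : normv q != 0 by rewrite normv_eq0.
  rewrite /psi powRD ?N0 ?implybT// powR_mulrn ?normv_ge0//.
  by move: (landau_wave _ _ _ _) (_ `^ _) => x y; field.
have FE q : F q = Complex (psi q * landau_wave (freq m) k 0 q)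
    (psi q * landau_wave (freq m) k (- (pi / 2)) q).
  rewrite /F -complexiE /landau_wave addr0 cosBpihalf sinBpihalf.
  rewrite -(mulrA 4^-1) normv_perpv.
  rewrite /expi; move: (cos _) (sin _) (psi _) (transverse2 _ _) (dotv q k) => *.
  by congr Complex => /=; ring.
have DE kappa : \int[mu3]_(p in @vec R @^-1` euclidean_ball rho)
    (psi (vec p) * landau_wave (freq m) k kappa (vec p)) =
    Lambda0 / 8 * - (2 * I kappa).
  have [iL LE] := Rintegral_landau_wave (freq l) (freq m) kappa Gw.
  rewrite /I freqB -LE -(RintegralZl _ measurableT iL) Rintegral_mkcond.
  apply: eq_Rintegral => p _; rewrite patchE /k freqD /radial_power.
  case: ifPn; rewrite ?inE ?notin_setE/= /euclidean_ball/=.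
    by move=> ->; rewrite -freqD psiE.
  by move=> /negP/negbTE ->; rewrite mul0r mulr0.
have -> : landau_mode (fun r => Lambda0 / 8 * r `^ (gamma + 2)) l m =
    - 4 * Complex
      (\int[mu3]_(p in @vec R @^-1` euclidean_ball rho) complex.Re (F (vec p)))
      (\int[mu3]_(p in @vec R @^-1` euclidean_ball rho) complex.Im (F (vec p))).
  by [].
under eq_Rintegral do rewrite FE /=.
rewrite DE; under eq_Rintegral do rewrite FE /=.
rewrite DE.
have -> : (-4 : R[i]) = (-4)%:C%C by rewrite rmorphN rmorph_nat.
by congr Complex => /=; field.
Qed.

End landau_modes.

(** * Passage to the limit *)

Section convergence.
Context {R : realType}.

Lemma sqrt_add_sqr_le (x y : R) : Num.sqrt (x ^+ 2 + y ^+ 2) <= `|x| + `|y|.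
Proof.
rewrite -[leRHS]ger0_norm ?addr_ge0// -sqrtr_sqr ler_wsqrtr// sqrrD !norm_sqr.
by rewrite -subr_ge0 (_ : _ - _ = `|x| * `|y| *+ 2) ?mulrn_wge0 ?mulr_ge0//; ring.
Qed.

Lemma cvg_Complex (f g : R -> R) (F : set_system R) (FF : Filter F) (a b : R) :
  f x @[x --> F] --> a -> g x @[x --> F] --> b ->
  Complex (f x) (g x) @[x --> F] --> (Complex a b : R[i]^o).
Proof.
move=> fa gb; apply/(@cvgrPdist_lt R[i] (R[i]^o : normedModType R[i])) => e.
rewrite ltcE/= => /andP[/eqP e0i e0].
have -> : e = (complex.Re e)%:C%C by case: e e0i {e0} => x y /= ->.
move: (complex.Re e) e0 => {e0i} {}e e0.
have e2 : 0 < e / 2 by rewrite divr_gt0.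
have fae := (@cvgrPdist_lt _ _ _ _ FF f a).1 fa _ e2.
have gbe := (@cvgrPdist_lt _ _ _ _ FF g b).1 gb _ e2.
near=> x.
rewrite normc_def ltcR /=.
have fx : `|a - f x| < e / 2 by near: x.
have gx : `|b - g x| < e / 2 by near: x.
rewrite (@le_lt_trans _ _ (`|a - f x| + `|b - g x|))//; last by lra.
exact: sqrt_add_sqr_le.
Unshelve. all: end_near. Qed.

End convergence.

Section mode_convergence.
Context {R : realType}.
Local Notation mu1 := (@lebesgue_measure R).
Local Notation mu2 := (sf_product mu1 mu1).
Local Notation mu3 := (sf_product mu2 mu1).

(** The cross-section tends to [Lambda0] and the second moment to [0]. *)
Lemma mean_scattered_cvg (G : R -> R) (rho Lambda0 : R) (m v : 'rV[R]_3) (k : R)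
    (b : R -> R -> R) :
  0 <= rho -> admissible_weight G rho -> 0 <= Lambda0 ->
  (forall eps, 0 < eps -> angular_function (b eps)) ->
  concentrates_on_grazing b Lambda0 ->
  \int[mu3]_p (G (normv (vec p)) *
    mean_scattered m v k (angular_density (b eps)) p) @[eps --> 0^'+] -->
  Lambda0 * \int[mu3]_p (G (normv (vec p)) * grazing m v k (vec p)).
Proof.
move=> rho0 Gw L0 bang bgraz.
have M0 := second_moment_cvg0 L0 bang bgraz.
have [/fine_cvgP[bfin bcvg] _] := bgraz.
set E := \int[mu3]_p (_ * grazing _ _ _ _).
set I := \int[mu3]_p (G (normv (vec p)) * normv (vec p)).
pose C := grazing_constant (normv v * rho) * normv v * I.
apply/cvgrPdist_le => e e0.
pose d := e / (2 * (`|E| + `|C| + 1)).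
have d0 : 0 < d by rewrite divr_gt0// mulr_gt0// ltr_wpDl// addr_ge0.
have dE : d * (`|E| + `|C| + 1) = e / 2.
  by rewrite /d; field; rewrite gt_eqF// ltr_wpDl// addr_ge0.
near=> eps.
have eps0 : 0 < eps by near: eps; exact: nbhs_right_gt.
have bf : cross_section (b eps) \is a fin_num by near: eps.
have Ld : `|Lambda0 - fine (cross_section (b eps))| <= d.
  by near: eps; move/cvgrPdist_le : bcvg; exact.
have := small_angle_angular_density (bang _ eps0) bf.
move=> Bd; have [_ B0 _ _] := Bd.
have : `|0 - \int[mu1]_t (angular_density (b eps) t * (1 - cos t) ^+ 2)| <= d.
  by near: eps; move/cvgrPdist_le : M0; exact.
set M := \int[mu1]_t _; rewrite sub0r normrN => Md.
have := Rintegral_mean_scattered_taylor m v k rho0 Gw Bd.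
rewrite -fine_cross_section//; last exact: bang.
rewrite -/E -/I -/M; set J := \int[mu3]_p _ => J_taylor.
rewrite (_ : _ - J = (Lambda0 - fine (cross_section (b eps))) * E
  - (J - fine (cross_section (b eps)) * E)); last by ring.
rewrite (le_trans (ler_normB _ _))//.
have h1 : `|(Lambda0 - fine (cross_section (b eps))) * E| <= d * `|E|.
  by rewrite ler_normM.
have h2 : `|J - fine (cross_section (b eps)) * E| <= `|C| * d.
  apply: (le_trans J_taylor); rewrite (_ : _ * M * I = C * M); last first.
    by rewrite /C; ring.
  by rewrite (le_trans (ler_norm _))// ler_normM.
have := ltW d0; lra.
Unshelve. all: end_near. Qed.

End mode_convergence.

Theorem proposition5 (R : realType) (gamma Lambda0 : R) (b : R -> R -> R)
    (j h : 'rV[R]_3 -> 'rV[R]_3)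
    (gamma_range : -3 <= gamma <= 1)
    (Lambda0_ge0 : 0 <= Lambda0)
    (b_angular : forall eps : R, 0 < eps -> angular_function (b eps))
    (b_grazing : concentrates_on_grazing b Lambda0)
    (frame : forall q : 'rV[R]_3, q != 0 ->
       orthonormal3 (unitv q) (j q) (h q))
    (l m : 'rV[int]_3) :
  boltzmann_mode j h (variable_collision_kernel gamma (b eps)) l m
    @[eps --> 0^'+]
    --> (landau_mode (fun r => Lambda0 / 8 * r `^ (gamma + 2)) l m : R[i]^o).
Proof.
have /andP[gamma3 _] := gamma_range.
have rho0 := lambda_pi_gt0 (R := R).
have Gw := admissible_radial_power rho0 gamma3.
rewrite landau_modeE//.
have J k := @mean_scattered_cvg R _ _ Lambda0 (freq m) (2^-1 *: freq (l - m)) k b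
  (ltW rho0) Gw Lambda0_ge0 b_angular b_grazing.
apply: cvg_trans; last exact: (cvg_Complex _ (J 0) (J (- (pi / 2)))).
apply: near_eq_cvg.
have [/fine_cvgP[bfin _] _] := b_grazing.
near=> eps.
have eps0 : 0 < eps by near: eps; exact: nbhs_right_gt.
have bf : cross_section (b eps) \is a fin_num by near: eps.
rewrite boltzmann_modeE//; first exact: b_angular.
exact: small_angle_angular_density (b_angular _ eps0) bf.
Unshelve. all: end_near. Qed.
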